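(* Suppose that $(\mathcal{A},\varphi,\varphi')$ is an infinitesimal non-commutative probability space. Let $a_1,a_2,\dots$ be a sequence in $\mathcal{A}$ with identical distribution, which are infinitesimally independent (free, Boolean, monotone). Assume also that $\varphi(a_1)=\varphi'(a_1)=0$, $\varphi(a_1^2)=1$, and $\varphi'(a_1^2)=\alpha$. For each $N\in\mathbb{N}$ let $S_N=(a_1+\cdots+a_N)/\sqrt N$. Then for every $k\in\mathbb{N}$, $$\lim_{N\to\infty}\varphi'(S_N^k)=\int t^k\,d\mu'(t),$$ where $\mu'$ is as follows. - Free case: $\mu'$ is a signed measure such that $\mu'=\alpha(\mu_1-\mu_2)$ with $$d\mu_1(t)=\frac{1}{2\pi}\frac{t^2}{\sqrt{4-t^2}}1_{(-2,2)}(t)\,dt,\qquad d\mu_2(t)=\frac{1}{\pi\sqrt{4-t^2}}1_{(-2,2)}(t)\,dt.$$ - Boolean case: $\mu'=f''$ with $df(t)=\frac{\alpha}{2}(\delta_{-1}-\delta_1)(t)$. - Monotone case: $\mu'=f''$ with $df(t)=\frac{-\alpha}{\pi}\frac{t}{2\sqrt{2-t^2}}1_{(-\sqrt2,\sqrt2)}(t)\,dt$.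
   Context: An infinitesimal non-commutative probability space $(\mathcal{A},\varphi,\varphi')$ is a unital complex algebra with linear functionals $\varphi,\varphi'$ such that $\varphi(1)=1$, $\varphi'(1)=0$. Identical distribution: $\varphi(a_i^k)$ and $\varphi'(a_i^k)$ do not depend on $i$, for all $k$. In the Boolean and monotone cases $f$ is a function of bounded variation on a closed interval, set to $0$ outside it, and $\mu'=f''$ is its second derivative in the distributional sense, a compactly supported distribution; $\int t^k\,d\mu'(t)$ means the pairing of $f''$ with $t^k$, that is, $-\int kt^{k-1}\,df(t)$. The sequence $(a_i)_{i\ge1}$ is infinitesimally independent if the unital algebras $\mathcal{A}_i=\mathrm{alg}(1,a_i)$ generated by the $a_i$ are so, in one of the following three senses. (Free) For $i_1\ne i_2\ne\cdots\ne i_n$ (consecutive indices distinct), $c_j\in\mathcal{A}_{i_j}$, $\varphi(c_j)=0$: $\varphi(c_1\cdots c_n)=0$ and $\varphi'(c_1\cdots c_n)=\sum_j\varphi'(c_j)\varphi(c_1\cdots c_{j-1}c_{j+1}\cdots c_n)$. (Boolean) For $i_1\ne\cdots\ne i_n$, $c_j\in\mathcal{A}_{i_j}$: $\varphi(c_1\cdots c_n)=\prod_j\varphi(c_j)$ and $\varphi'(c_1\cdots c_n)=\sum_j\varphi'(c_j)\prod_{k\ne j}\varphi(c_k)$. (Monotone) For $c_k\in\mathcal{A}_{i_k}$ and $j$ with $i_{j-1}<i_j>i_{j+1}$ (one inequality eliminated if $j=1$ or $j=n$): $\varphi(c_1\cdots c_n)=\varphi(c_j)\varphi(c_1\cdots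 c_{j-1}c_{j+1}\cdots c_n)$ and $\varphi'(c_1\cdots c_n)=\varphi'(c_j)\varphi(c_1\cdots c_{j-1}c_{j+1}\cdots c_n)+\varphi(c_j)\varphi'(c_1\cdots c_{j-1}c_{j+1}\cdots c_n)$.
   Formalization: With unital algebras the Boolean and monotone hypotheses contradict φ(a_1)=0, φ(a_1²)=1 (word a_2·1·a_2), so these cases are also proved for the non-unital algebras generated by a_i; there the Boolean constant α/2 is corrected to α/4, since φ'(S_N²)=α, not 2α. *)

(* Defs.v *)
From mathcomp Require Import all_boot all_order all_algebra.
From mathcomp Require Import complex.
From mathcomp Require Import all_classical all_reals all_analysis.

Set Implicit Arguments.
Unset Strict Implicit.
Unset Printing Implicit Defensive.

Import Order.TTheory GRing.Theory Num.Theory.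
Import numFieldNormedType.Exports.

Local Open Scope classical_set_scope.
Local Open Scope ring_scope.
Local Open Scope complex_scope.

Section Independence.
Variables (R : realType) (A : algType R[i]).
Implicit Types (a : nat -> A) (B : nat -> set A).

Definition alg1 (x : A) : set A :=
  smallest [set M : set A | subalg_closed (mem M)] [set x].

(* The subalgebra generated by x alone, which need not contain the unit.
   If phi (a 0) = 0 and phi (a 0 ^+ 2) = phi (a 1 ^+ 2) = 1, the algebras
   alg1 (a i) are never Boolean or monotone independent in the sense below: a
   word such as (a 1) 1 (a 1), whose middle letter is taken in alg1 (a 0),
   would give phi (a 1 ^+ 2) = 0. For these two notions the algebras alg0 (a i)
   are the meaningful ones. For Boolean independent alg0 (a i), one has
   phi' (S_N ^+ 2) = alpha for N >= 1, while - \int 2 t df(t) = 2 alpha when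
   df = (alpha / 2) (delta_(-1) - delta_1): in that case the limit moments are
   those of f'' / 2, that is, df carries the constant alpha / 4. *)
Definition alg0 (x : A) : set A :=
  smallest [set M : set A | submod_closed (mem M) /\ GRing.mulr_2closed (mem M)]
           [set x].

Definition identically_distributed (phi phi' : {scalar A}) a :=
  forall i j k, phi (a i ^+ k) = phi (a j ^+ k) /\
                phi' (a i ^+ k) = phi' (a j ^+ k).

(* In the next definitions c_1 ... c_m is a word of length m = n.+1 >= 1 with
   the letter c_j taken from B (i j); [\prod_(l | l != j) c l] is the word with
   the j-th letter erased. *)
Definition alternating n (i : 'I_n -> nat) :=
  forall j l : 'I_n, l = j.+1 :> nat -> i j <> i l.

Definition inf_free (phi phi' : {scalar A}) B :=
  forall n (i : 'I_n.+1 -> nat) (c : 'I_n.+1 -> A),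
    alternating i -> (forall j, B (i j) (c j)) -> (forall j, phi (c j) = 0) ->
    phi (\prod_j c j) = 0 /\
    phi' (\prod_j c j) = \sum_j phi' (c j) * phi (\prod_(l | l != j) c l).

Definition inf_boolean (phi phi' : {scalar A}) B :=
  forall n (i : 'I_n.+1 -> nat) (c : 'I_n.+1 -> A),
    alternating i -> (forall j, B (i j) (c j)) ->
    phi (\prod_j c j) = \prod_j phi (c j) /\
    phi' (\prod_j c j) = \sum_j phi' (c j) * \prod_(l | l != j) phi (c l).

Definition peak n (i : 'I_n -> nat) (j : 'I_n) :=
  forall l : 'I_n, l.+1 = j :> nat \/ l = j.+1 :> nat -> (i l < i j)%N.

Definition inf_monotone (phi phi' : {scalar A}) B :=
  forall n (i : 'I_n.+1 -> nat) (c : 'I_n.+1 -> A) (j : 'I_n.+1),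
    (forall l, B (i l) (c l)) -> peak i j ->
    phi (\prod_l c l) = phi (c j) * phi (\prod_(l | l != j) c l) /\
    phi' (\prod_l c l) = phi' (c j) * phi (\prod_(l | l != j) c l)
                       + phi (c j) * phi' (\prod_(l | l != j) c l).

(* The variables are indexed from 0, so this is (a_1 + ... + a_N) / sqrt N;
   the value at N = 0 is irrelevant. *)
Definition normalized_sum a (N : nat) : A :=
  ((Num.sqrt (N%:R : R))^-1)%:C *: \sum_(j < N) a j.

End Independence.

Section Measures.
Variable R : realType.
Local Notation TR := (measurableTypeR R).
Implicit Types (nu : {charge set TR -> \bar R}) (f g : R -> R).

(* The scalar alpha = phi' (a_1 ^ 2) is complex in general, so it is kept outside
   the real measures below: mu' is alpha times the signed measure nu in the free
   case, and (alpha f)'' with f real in the other two.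
   Integral against a signed measure, through its Jordan decomposition; it does
   not depend on the Hahn decomposition chosen. *)
Definition charge_integral nu g : R :=
  let PN := cid (Hahn_decomposition nu) in
  let PNH := cid (projT2 PN) in
  let nuPN := projT2 PNH in
  \int[jordan_pos nuPN]_t g t - \int[jordan_neg nuPN]_t g t.

(* f is of bounded variation on [a, b], vanishes outside, and its Stieltjes
   (signed) measure is df; f is normalized to be right-continuous. *)
Definition bv_with_differential a b f (df : {charge set TR -> \bar R}) :=
  [/\ bounded_variation a b f,
      forall t, ~ (a <= t <= b) -> f t = 0
    & forall s t : R, s < t -> df [set` `]s, t]] = (f t - f s)%:E].

(* The pairing of the distribution f'' with t ^ k. *)
Definition second_derivative_moment (df : {charge set TR -> \bar R}) k : R :=
  - charge_integral df (fun t => k%:R * t ^+ k.-1).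

Definition free_density1 (t : R) : R :=
  (2 * pi)^-1 * (t ^+ 2 / Num.sqrt (4 - t ^+ 2)) * \1_`]-2, 2[ t.

Definition free_density2 (t : R) : R :=
  (pi * Num.sqrt (4 - t ^+ 2))^-1 * \1_`]-2, 2[ t.

Definition monotone_density (t : R) : R :=
  - pi^-1 * (t / (2 * Num.sqrt (2 - t ^+ 2)))
  * \1_`]- Num.sqrt 2, Num.sqrt 2[ t.

Definition with_density (h : R -> R) (X : set TR) : \bar R :=
  \int[lebesgue_measure]_(t in X) (h t)%:E.

End Measures.

(* Main.v *)
(* Put psi = phi + eps phi' with eps ^ 2 = 0. An infinitesimally independent
   sequence is exactly a sequence that is independent, in the ordinary sense, for
   the functional psi with values in the dual numbers, so one central limit
   argument over a commutative ring treats phi and phi' at once.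

   Write T for a_1 + ... + a_N and x for the next variable. Expanding (T + x)^k,
   the terms with one x vanish, those with two are given by independence
   (psi (x^2) psi (T^c) psi (T^(a+d)) for T^a x T^c x T^d in the free case), and
   those with at least three have degree less than k/2 - 1 in N. So the finite
   difference of psi (T^k) in N shows that psi (T^(2p)) is a polynomial in N with
   leading term g_p psi (x^2)^p N^p, where g_p satisfies the recursion of the
   Catalan numbers (free), is 1 (Boolean) or is (2p-1)!! / p! (monotone). As
   psi (x^2) = 1 + eps alpha, the coefficient of eps gives p g_p alpha as the limit
   of phi' (S_N^(2p)), and the odd moments tend to 0.

   The limit charges have densities t^j / sqrt (r^2 - t^2) up to a constant, whose
   moments follow from the derivative of t^(k+1) sqrt (r^2 - t^2). An integral
   against a difference m1 - m2 of finite measures does not depend on the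
   decomposition, since m1 + jordan_neg = m2 + jordan_pos. *)
Require Import Defs.
From HB Require Import structures.
From mathcomp Require Import all_boot all_order all_algebra.
From mathcomp Require Import complex.
From mathcomp Require Import all_classical all_reals all_analysis.
From mathcomp Require Import measurable_realfun.
From mathcomp Require Import ring lra zify.
Set Implicit Arguments.
Unset Strict Implicit.
Unset Printing Implicit Defensive.
Import Order.TTheory GRing.Theory Num.Theory.
Import numFieldNormedType.Exports.

Local Open Scope ring_scope.

(** * Finite differences *)

Section FiniteDifferences.
Variable D : comNzRingType.
Implicit Types (f g : nat -> D) (c : D) (e t : nat).

(** Finite differences avoid division: the scalars form an arbitrary commutative ring, and the e-th
    difference is e! times a leading coefficient, so the constants carried along are the integers p!
    g_p, and factorials are divided out only in the limit. In the increment of psi (T^k), words with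
    two letters x have k - 2 letters T, and those with three or more have at most k - 3. For k = 2p
    + 2 the halves round down to p and p - 1, which removes the remainder from the leading term. The
    degree bound on odd moments is needed too, since products of two odd moments occur among the
    two-letter terms. In the Boolean and monotone cases it is enough that psi is an additive map
    from A to the dual numbers. Freeness requires centering, that is, subtracting psi (c) 1 with psi
    (c) a dual number, and this leaves A. Hence the free argument takes place in the algebra A + eps
    A over the dual numbers. *)

Definition diff f n := f n.+1 - f n.

(* The e-th difference of f is the constant c: on a Q-algebra, f is a polynomial
   function of degree at most e with leading coefficient c / e!. *)
Fixpoint lead e c f : Prop :=
  if e is e'.+1 then lead e' c (diff f) else forall n, f n = c.

Lemma eq_lead e c f g : f =1 g -> lead e c f -> lead e c g.
Proof.
elim: e f g => [|e IH] f g fg /=; first by move=> h n; rewrite -fg h.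
by apply: IH => n; rewrite /diff !fg.
Qed.

Lemma lead0 e : lead e 0 (fun=> 0).
Proof.
elim: e => [|e IH] //=; apply: eq_lead IH => n.
by rewrite /diff subrr.
Qed.

Lemma leadD e c d f g :
  lead e c f -> lead e d g -> lead e (c + d) (fun n => f n + g n).
Proof.
elim: e f g => [|e IH] f g /= hf hg; first by move=> n; rewrite hf hg.
apply: eq_lead (IH _ _ hf hg) => n.
by rewrite /diff opprD addrACA.
Qed.

Lemma leadZ e c f a : lead e c f -> lead e (a * c) (fun n => a * f n).
Proof.
elim: e f => [|e IH] f /= hf; first by move=> n; rewrite hf.
apply: eq_lead (IH _ hf) => n.
by rewrite /diff mulrBr.
Qed.

Lemma lead_bump e c f : lead e c f -> lead e.+1 0 f.
Proof.
elim: e f => [|e IH] f hf; first by move=> n; rewrite /diff !hf subrr.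
exact: (IH _ hf).
Qed.

Lemma leadW e e' c f : (e < e')%N -> lead e c f -> lead e' 0 f.
Proof.
elim: e' => // e' IH; rewrite ltnS leq_eqVlt => /orP[/eqP -> | lt] h.
  exact: lead_bump h.
exact: lead_bump (IH lt h).
Qed.

Lemma lead_sum (I : Type) (r : seq I) (P : pred I) e (c : I -> D)
    (F : I -> nat -> D) :
  (forall i, P i -> lead e (c i) (F i)) ->
  lead e (\sum_(i <- r | P i) c i) (fun n => \sum_(i <- r | P i) F i n).
Proof.
move=> h; elim: r => [|i r IH].
  by rewrite big_nil; apply: eq_lead (lead0 e) => n; rewrite big_nil.
rewrite big_cons; case: ifP => Pi.
  by apply: eq_lead (leadD (h i Pi) IH) => n; rewrite big_cons Pi.
by apply: eq_lead IH => n; rewrite big_cons Pi.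
Qed.

(** Discrete Leibniz rule: the difference of f g is (diff f) g + f (diff g) + (diff f)(diff g), and
    the last term has lower degree. The binomial reflects the factorial normalization, and the two
    main terms combine by Pascal's rule. *)
Lemma leadM e e' c c' f g :
  lead e c f -> lead e' c' g ->
  lead (e + e') (c * c' *+ 'C(e + e', e)) (fun n => f n * g n).
Proof.
have [m] := ubnP (e + e'); elim: m => // m IH in e e' c c' f g *.
case: e => [|e].
  move=> _ hf hg; rewrite add0n bin0 mulr1n.
  by apply: eq_lead (leadZ c hg) => n; rewrite hf.
case: e' => [|e'].
  move=> _ hf hg; rewrite addn0 binn mulr1n mulrC.
  by apply: eq_lead (leadZ c' hf) => n; rewrite hg mulrC.
rewrite addSn addnS !ltnS => le_m hf hg.
have h1 : lead (e + e'.+1) (c * c' *+ 'C(e + e'.+1, e))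
    (fun n => diff f n * g n).
  by apply: (IH _ _ _ _ (diff f) g _ hf hg); rewrite addnS.
have h2 : lead (e.+1 + e') (c * c' *+ 'C(e.+1 + e', e.+1))
    (fun n => f n * diff g n).
  by apply: (IH _ _ _ _ f (diff g) _ hf hg); rewrite addSn.
have h3 : lead (e + e').+1 0 (fun n => diff f n * diff g n).
  apply: lead_bump; apply: (IH _ _ _ _ (diff f) (diff g) _ hf hg).
  exact: ltnW le_m.
rewrite addnS in h1; rewrite addSn in h2.
rewrite binS mulrnDr addrC -[X in lead _ X _]addr0.
have := leadD (leadD h1 h2) h3.
apply: eq_lead => n; rewrite /diff; ring.
Qed.

(* Weight t means degree at most t / 2 (rounded down). *)
Definition weight t f := exists c, lead t./2 c f.

Lemma eq_weight t f g : f =1 g -> weight t f -> weight t g.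
Proof. by move=> fg [c h]; exists c; apply: eq_lead h. Qed.

Lemma weightW t t' f : (t <= t')%N -> weight t f -> weight t' f.
Proof.
move=> /half_leq; rewrite leq_eqVlt => /orP[/eqP e | lt] [c h].
  by exists c; rewrite -e.
by exists 0; apply: leadW h.
Qed.

Lemma weight_const t c : weight t (fun=> c).
Proof. by apply: (@weightW 0) => //; exists c. Qed.

Lemma weightD t f g :
  weight t f -> weight t g -> weight t (fun n => f n + g n).
Proof. by move=> [c h] [d k]; exists (c + d); apply: leadD. Qed.

Lemma weightZ t f a : weight t f -> weight t (fun n => a * f n).
Proof. by move=> [c h]; exists (a * c); apply: leadZ. Qed.

Lemma weightB t f g :
  weight t f -> weight t g -> weight t (fun n => f n - g n).
Proof.
move=> hf /(weightZ (-1)) hg; apply: eq_weight (weightD hf hg) => n.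
by rewrite mulN1r.
Qed.

Lemma weightM t t' f g :
  weight t f -> weight t' g -> weight (t + t') (fun n => f n * g n).
Proof.
move=> [c h] [d k]; apply: (@weightW (t./2 + t'./2).*2).
  by rewrite doubleD leq_add // -[leqRHS]odd_double_half leq_addl.
by eexists; rewrite doubleK; apply: leadM h k.
Qed.

Lemma weight_sum (I : Type) (r : seq I) t (F : I -> nat -> D) :
  (forall i, weight t (F i)) -> weight t (fun n => \sum_(i <- r) F i n).
Proof.
move=> h; elim: r => [|i r IH].
  by apply: eq_weight (weight_const t 0) => n; rewrite big_nil.
by apply: eq_weight (weightD (h i) IH) => n; rewrite big_cons.
Qed.

End FiniteDifferences.

(** * Recursion for the moments of the partial sums *)

(** Each word of the expansion is cut at its first [x], and what follows stays unexpanded. Repeating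
    the cut isolates the words with exactly one and exactly two letters [x]. *)
Lemma exprD_first (A : nzRingType) (t x : A) k :
  (t + x) ^+ k
  = t ^+ k + \sum_(a < k) t ^+ a * x * (t + x) ^+ (k.-1 - a).
Proof.
elim: k => [|k IH]; first by rewrite big_ord0 addr0.
rewrite exprS mulrDl {1}IH mulrDr -exprS mulr_sumr -addrA; congr (_ + _).
rewrite big_ord_recl /= subn0 expr0 mul1r addrC; congr (_ + _).
apply: eq_bigr => i _; rewrite !mulrA exprS /bump /= add1n.
by congr (_ * _ ^+ _); lia.
Qed.

Section MomentRecursion.
Variables (D : comNzRingType) (A : nzRingType) (psi : {additive A -> D}).
Variable x : nat -> A.

Definition psum N := \sum_(i < N) x i.

Definition moment k N := psi (psum N ^+ k).

(* Words in x N (letter true) and psum N (letter false). *)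
Definition word (w : seq bool) N := \prod_(b <- w) (if b then x N else psum N).

(** The form needed inside a strong induction on the moments. Letters [x N] cost nothing, because
    the moments of [x N] do not depend on [N]. *)
Definition weight_word_below k := (forall j, (j < k)%N -> weight j (moment j)) ->
  forall w, (count negb w < k)%N ->
  weight (count negb w) (fun N => psi (word w N)).

Lemma psumS N : psum N.+1 = psum N + x N.
Proof. by rewrite /psum big_ord_recr. Qed.

Lemma exprSpsum k N : psum N.+1 ^+ k = psum N ^+ k
  + \sum_(a < k) psum N ^+ a * x N * psum N.+1 ^+ (k.-1 - a).
Proof. by rewrite psumS exprD_first. Qed.

Lemma word_cat w1 w2 N : word (w1 ++ w2) N = word w1 N * word w2 N.
Proof. by rewrite /word big_cat. Qed.

Lemma word_nseq b n N :
  word (nseq n b) N = (if b then x N else psum N) ^+ n.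
Proof.
elim: n => [|n IH]; first by rewrite /word big_nil expr0.
by rewrite /word /= big_cons -/(word _ _) IH exprS.
Qed.

Lemma word_cons b w N :
  word (b :: w) N = (if b then x N else psum N) * word w N.
Proof. by rewrite /word big_cons. Qed.

Lemma word0 N : word [::] N = 1.
Proof. by rewrite /word big_nil. Qed.

(** Every factor [psum N.+1] is [psum N + x N], and choosing [x N] only lowers the number of letters
    [psum N]. *)
Lemma weight_word_expr k w f :
  weight_word_below k -> (forall j, (j < k)%N -> weight j (moment j)) ->
  (count negb w + f < k)%N ->
  weight (count negb w + f) (fun N => psi (word w N * psum N.+1 ^+ f)).
Proof.
move=> hw hk; elim: f w => [|f IH] w lt.
  rewrite addn0; apply: eq_weight (hw hk w _) => [n|]; last by lia.
  by rewrite expr0 mulr1.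
have h1 := IH (w ++ [:: false]); have h2 := IH (w ++ [:: true]).
rewrite !count_cat /= in h1 h2.
have h3 := weightD (h1 _) (weightW _ (h2 _)).
apply: eq_weight (weightW _ (h3 _ _ _)); try by lia.
move=> n; rewrite !word_cat !word_cons !word0 !mulr1 exprS.
by rewrite -raddfD -mulrDl -mulrDr -psumS mulrA.
Qed.

Hypothesis psi1 : psi 1 = 1.
Hypothesis mean0 : forall a b N, psi (psum N ^+ a * x N * psum N ^+ b) = 0.
Hypothesis weight_words : forall k, weight_word_below k.

(** [exprD_first] is used three times: the words with a single [x] vanish by [mean0], and the inner
    sum over [e] collects the words with at least three. *)
Lemma diff_moment k N :
  diff (moment k.+2) N
  = \sum_(a < k.+2) \sum_(c < (k.+1 - a)%N)
     (psi (psum N ^+ a * x N * psum N ^+ c * x N * psum N ^+ (k - a - c))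
      + \sum_(e < (k - a - c)%N)
          psi (psum N ^+ a * x N * psum N ^+ c * x N * psum N ^+ e * x N
               * psum N.+1 ^+ ((k - a - c).-1 - e))).
Proof.
rewrite /diff /moment exprSpsum raddfD addrC addKr raddf_sum.
apply: eq_bigr => a _ /=.
rewrite exprSpsum mulrDr raddfD mean0 add0r mulr_sumr raddf_sum.
apply: eq_bigr => c _ /=.
have -> : ((k.+1 - a).-1 - c = k - a - c)%N by lia.
rewrite exprSpsum !mulrDr raddfD !mulrA; congr (_ + _).
by rewrite mulr_sumr raddf_sum; apply: eq_bigr => e _; rewrite !mulrA.
Qed.

(** For each notion, [v] is psi (x^2), [G p] is p! g_p, and [kappa a c d] is the multiple of v^(p+1)
    in the p-th difference of psi (T^a x T^c x T^d) when a + c + d = 2p. In [GS] the index a = 2p +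
    1 contributes an empty sum. *)
Variables (v : D) (G : nat -> nat) (kappa : nat -> nat -> nat -> nat).

Hypothesis G0 : G 0 = 1%N.
Hypothesis GS : forall p, G p.+1 =
  (\sum_(a < p.*2.+2) \sum_(c < p.*2.+1 - a) kappa a c (p.*2 - a - c))%N.
Hypothesis lead_pair : forall p,
  (forall q, (q <= p)%N -> lead q (v ^+ q *+ G q) (moment q.*2)) ->
  (forall j, (j < p.*2.+2)%N -> weight j (moment j)) ->
  forall a c d, (a + c + d = p.*2)%N ->
  lead p (v ^+ p.+1 *+ kappa a c d)
    (fun N => psi (psum N ^+ a * x N * psum N ^+ c * x N * psum N ^+ d)).

Theorem lead_moment : (forall k, weight k (moment k))
  /\ forall p, lead p (v ^+ p *+ G p) (moment p.*2).
Proof.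
(* Both claims go through one strong induction, since [lead_pair] uses lower leading terms together
   with the degree bounds of all lower moments, odd ones included. *)
suff: forall k, weight k (moment k)
    /\ (forall p, k = p.*2 -> lead p (v ^+ p *+ G p) (moment k)).
  by move=> h; split=> [k|p]; [case: (h k) | case: (h p.*2) => _; apply].
move=> k; have [m] := ubnP k; elim: m => // m IH in k *.
rewrite ltnS => le_km.
case: k le_km => [|[|k]] le_km.
- have h0 : lead 0 1 (moment 0) by move=> n; rewrite /moment expr0 psi1.
  split; first by exists 1.
  by case=> // _; rewrite expr0 G0.
- split; last by case.
  exists 0 => n; rewrite /moment expr1 /psum raddf_sum big1 // => i _.
  by have := mean0 0 0 i; rewrite !expr0 mulr1 mul1r.
have hW j : (j < k.+2)%N -> weight j (moment j).
  by move=> lt; case: (IH j _) => //; lia.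
(* Two letters [x] leave k letters [psum]. The guard excludes the range where [k - a - c] is
   truncated. *)
have wQ a c : weight k (fun N => if (a + c <= k)%N then
    psi (psum N ^+ a * x N * psum N ^+ c * x N * psum N ^+ (k - a - c)) else 0).
  case: leqP => le; last exact: weight_const.
  pose w := nseq a false ++ true :: nseq c false ++ true :: nseq (k - a - c) false.
  have cw : count negb w = k.
    by rewrite /w; do 4 rewrite ?count_cat ?count_nseq /=; lia.
  rewrite -cw; apply: eq_weight (weight_words hW (w := w) _) => [n|].
    by rewrite /w !(word_cat, word_cons, word_nseq) !mulrA cw.
  by rewrite cw.
(* A third [x] leaves at most k - 1 letters [psum]. *)
have wR a c e : weight k.-1 (fun N => if (a + c + e < k)%N then
    psi (psum N ^+ a * x N * psum N ^+ c * x N * psum N ^+ e * x N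
               * psum N.+1 ^+ ((k - a - c).-1 - e)) else 0).
  case: ltnP => lt; last exact: weight_const.
  pose w := nseq a false ++ true :: nseq c false ++ true :: nseq e false ++ [:: true].
  have cw : count negb w = (a + c + e)%N.
    by rewrite /w; do 4 rewrite ?count_cat ?count_nseq /=; lia.
  have := weight_word_expr (w := w) (f := (k - a - c).-1 - e)
    (@weight_words k.+2) hW.
  rewrite cw => h; apply: eq_weight (weightW _ (h _)) => [n||]; try lia.
  by rewrite /w !(word_cat, word_cons, word_nseq, word0) !mulrA mulr1.
split.
  (* By computation [k.+2./2] is a successor, so [lead] unfolds to a statement about the
     difference. *)
  suff: weight k (diff (moment k.+2)) by [].
  apply: eq_weight (fun n => esym (diff_moment k n)) _.
  apply: weight_sum => a; apply: weight_sum => c; apply: weightD.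
    apply: eq_weight (wQ a c) => n; rewrite ifT //.
    by have := ltn_ord c; have := ltn_ord a; lia.
  apply: weight_sum => e; apply: eq_weight (weightW _ (wR a c e)) => [n|]; last lia.
  by rewrite ifT //; have := ltn_ord e; lia.
case=> // p; rewrite doubleS => -[ek]; rewrite {}ek in le_km hW wQ wR *.
suff: lead p (v ^+ p.+1 *+ G p.+1) (diff (moment p.*2.+2)) by [].
apply: eq_lead (fun n => esym (diff_moment p.*2 n)) _.
rewrite GS -sumrMnr; apply: lead_sum => a _; rewrite -sumrMnr.
apply: lead_sum => c _; rewrite -[X in lead _ X _]addr0; apply: leadD.
  apply: lead_pair => //.
    by move=> q le_qp; have [|_] := IH q.*2 _; [lia | apply].
  by have := ltn_ord c; have := ltn_ord a; lia.
rewrite -[X in lead _ X _](_ : \sum_(e < (p.*2 - a - c)%N) (0 : D) = 0);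
  last exact: big1_eq.
apply: lead_sum => e _; have lt_e := ltn_ord e.
(* (2p - 1) / 2 rounds down to p - 1, and the existence of [e] forces p > 0, so the remainder
   contributes 0 to the p-th difference. *)
have [d hd] := wR a c e.
apply: eq_lead (leadW _ hd) => [n|]; last by lia.
by rewrite ifT //; lia.
Qed.

End MomentRecursion.

(** * Words and alternating products *)

Section Span.
Variable A : nzRingType.

(** Sums suffice: expanding words creates no scalars, and in the free case the generating set is
    itself closed under scaling. *)
Inductive span (P : A -> Prop) : A -> Prop :=
| span0 : span P 0
| span_cons y z : P y -> span P z -> span P (y + z).

Lemma span_in (P : A -> Prop) y : P y -> span P y.
Proof. by move=> h; rewrite -[y]addr0; apply: span_cons h (span0 P). Qed.

Lemma spanD (P : A -> Prop) y z : span P y -> span P z -> span P (y + z).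
Proof.
elim=> [|u v Pu _ IH] hz; first by rewrite add0r.
by rewrite -addrA; apply: span_cons Pu (IH hz).
Qed.

Lemma span_sum (P : A -> Prop) n (F : 'I_n -> A) :
  (forall i, span P (F i)) -> span P (\sum_(i < n) F i).
Proof. by move=> h; elim/big_rec: _ => [|i y _]; [left | apply: spanD]. Qed.

Lemma span_mull (P Q : A -> Prop) a y :
  (forall z, P z -> span Q (a * z)) -> span P y -> span Q (a * y).
Proof.
move=> h; elim=> [|u v Pu _ IH]; first by rewrite mulr0; left.
by rewrite mulrDr; apply: spanD (h u Pu) IH.
Qed.

Lemma eq_span (D : nzRingType) (P : A -> Prop) (f g : A -> D) y :
  {morph f : u v / u + v} -> {morph g : u v / u + v} ->
  (forall z, P z -> f z = g z) -> span P y -> f y = g y.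
Proof.
have morph0 (h : A -> D) : {morph h : u v / u + v} -> h 0 = 0.
  by move=> hD; apply: (@addrI _ (h 0)); rewrite -hD !addr0.
move=> fD gD h; elim=> [|u v Pu _ IH]; first by rewrite !morph0.
by rewrite fD gD IH h.
Qed.

End Span.

Section LetterLists.
Variables (A : nzRingType) (B : nat -> A -> Prop) (x : nat -> A).
Hypothesis BM : forall i c d, B i c -> B i d -> B i (c * d).
Hypothesis Bx : forall i, B i (x i).
Implicit Types s : seq (nat * A).

Definition prodl s := \prod_(c <- s) c.2.

Fixpoint letters s := if s is c :: s' then B c.1 c.2 /\ letters s' else True.

Definition alt s := sorted (fun i j => i != j) (unzip1 s).

Lemma prodl_cons c s : prodl (c :: s) = c.2 * prodl s.
Proof. by rewrite /prodl big_cons. Qed.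

Lemma prodl_cat s1 s2 : prodl (s1 ++ s2) = prodl s1 * prodl s2.
Proof. by rewrite /prodl big_cat. Qed.

Lemma letters_cat s1 s2 : letters s1 -> letters s2 -> letters (s1 ++ s2).
Proof. by move=> h1 h2; elim: s1 h1 => //= c s1 IH [hc /IH]. Qed.

Definition top_letters N s := [seq i == N | i <- unzip1 s].

(* The list s contributes to the expansion of the word w in the letters x i
   with i <= N, after merging equal neighbours. *)
Definition expands w N s :=
  [/\ letters s, alt s, all (fun i => (i <= N)%N) (unzip1 s),
      forall b, head b (top_letters N s) = head b w
    & forall b, last b (top_letters N s) = last b w].

(** Merging equal neighbours preserves the types of the two ends, and these are all that [expands]
    tracks. Quantifying over the default [b] also makes [s] and [w] empty together. *)
Lemma expands_cons w N i c s : (i <= N)%N -> B i c -> expands w N s ->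
  exists2 s', prodl s' = c * prodl s & expands ((i == N) :: w) N s'.
Proof.
move=> le_iN Bc; case: s => [|[j d] s] [Ls As les hd lt].
  exists [:: (i, c)]; first by rewrite prodl_cons.
  by split=> //=; rewrite ?le_iN // => b; exact: (lt (i == N)).
have [eij|neq_ij] := eqVneq i j; last first.
  exists ((i, c) :: (j, d) :: s); first by rewrite prodl_cons.
  split=> //=; rewrite ?le_iN //; first by rewrite /alt /= neq_ij.
  by move=> _; exact: (lt (i == N)).
subst j; case: Ls => Bd Ls; exists ((i, c * d) :: s).
  by rewrite !prodl_cons mulrA.
split=> //=; first by split=> //; apply: BM.
by move=> _; exact: (lt (i == N)).
Qed.

(** Independence speaks of alternating products only. This reduces identities about words in [x N]
    and [psum x N] to such products, by additivity. *)
Lemma word_span w N :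
  span (fun y => exists2 s, y = prodl s & expands w N s) (word x w N).
Proof.
elim: w => [|b w IH].
  by rewrite word0; apply: span_in; exists [::]; rewrite ?/prodl ?big_nil.
have step i : (i <= N)%N ->
  span (fun y => exists2 s, y = prodl s & expands ((i == N) :: w) N s)
    (x i * word x w N).
  move=> le_iN; apply: span_mull IH => _ [s -> hs].
  by have [s' <- hs'] := expands_cons le_iN (Bx i) hs; apply: span_in; exists s'.
rewrite word_cons; case: b.
  by have := step N (leqnn N); rewrite eqxx.
rewrite /psum mulr_suml; apply: span_sum => i.
by have := step i (ltnW (ltn_ord i)); rewrite ltn_eqF.
Qed.

End LetterLists.

(** * Boolean and monotone independence *)

(** The default of [head] makes an empty remainder count as starting with the other letter. *)
Lemma run_split b w : exists n w2,
  b :: w = nseq n.+1 b ++ w2 /\ head (~~ b) w2 = ~~ b.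
Proof.
elim: w => [|b1 w IH]; first by exists 0%N, [::].
have [->|ne] := eqVneq b1 b.
  by have [n [w2 [-> h]]] := IH; exists n.+1, w2.
by exists 0%N, (b1 :: w); split=> //=; case: (b) (b1) ne => -[].
Qed.

Lemma sum_even p m :
  (\sum_(a < p.*2.+1) (if ~~ odd a then m else 0) = p.+1 * m)%N.
Proof.
elim: p => [|p IH]; first by rewrite big_ord1 mul1n.
by rewrite doubleS 2!big_ord_recr /= IH /= !odd_double addn0 mulSn addnC.
Qed.

(** [a] and [d] have the same parity. If both are odd, their halves round down to a total of p - 1,
    so the product has no term of degree p; if both are even, the binomial is that of [leadM]. *)
Lemma lead_moment_mul (D : comNzRingType) (A : nzRingType)
    (psi : {additive A -> D}) (x : nat -> A) v (G : nat -> nat) p a d :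
  (forall q, (q <= p)%N -> lead q (v ^+ q *+ G q) (moment psi x q.*2)) ->
  (forall j, (j <= p.*2)%N -> weight j (moment psi x j)) ->
  (a + d = p.*2)%N ->
  lead p (v ^+ p *+ (if odd a then 0%N else 'C(p, a./2) * (G a./2 * G d./2)))
    (fun N => moment psi x a N * moment psi x d N).
Proof.
move=> hq hw ead; have := odd_double p; rewrite -ead oddD.
case: ifPn => [odd_a /= | /negPf even_a].
  case odd_d : (odd d) => // _.
  have [c1 h1] := hw a ltac:(lia); have [d1 h2] := hw d ltac:(lia).
  rewrite mulr0n; apply: leadW (leadM h1 h2).
  by move: (odd_double_half a) (odd_double_half d); rewrite odd_a odd_d; lia.
rewrite /= => even_d.
have ea : a = a./2.*2 by rewrite even_halfK ?even_a.
have ed : d = d./2.*2 by rewrite even_halfK ?even_d.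
have h1 := hq a./2 ltac:(lia); have h2 := hq d./2 ltac:(lia).
have := leadM h1 h2; rewrite -ea -ed.
have -> : (a./2 + d./2 = p)%N by lia.
have epq : (d./2 = p - a./2)%N by lia.
rewrite mulrnAl mulrnAr -!mulrnA -exprD epq subnKC; last by lia.
by congr (lead _ (_ *+ _) _); lia.
Qed.

Section BooleanMonotone.
Variables (D : comNzRingType) (A : nzRingType) (psi : {additive A -> D}).
Variables (B : nat -> A -> Prop) (x : nat -> A).
Hypothesis BM : forall i c d, B i c -> B i d -> B i (c * d).
Hypothesis Bx : forall i, B i (x i).
Hypothesis psi1 : psi 1 = 1.
Hypothesis same_moments : forall i k, psi (x i ^+ k) = psi (x 0%N ^+ k).
Hypothesis mean : psi (x 0%N) = 0.

Let xmean i : psi (x i) = 0.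
Proof. by have := same_moments i 1; rewrite !expr1 mean. Qed.

Definition list_boolean := forall s, s != [::] -> letters B s -> alt s ->
  psi (prodl s) = \prod_(c <- s) psi c.2.

Definition list_monotone := forall s1 s2 i c,
  letters B s1 -> letters B s2 -> B i c ->
  (s1 != [::] -> (last i (unzip1 s1) < i)%N) ->
  (s2 != [::] -> (head i (unzip1 s2) < i)%N) ->
  psi (prodl s1 * c * prodl s2) = psi c * psi (prodl s1 * prodl s2).

Lemma BXn i n : B i (x i ^+ n.+1).
Proof. by elim: n => [|n IH]; rewrite ?expr1 // exprS; apply: BM. Qed.

Section Boolean.
Hypothesis psi_list : list_boolean.

(** At the joint one of the two indices is [N] and the other is below [N], so the concatenation is
    still alternating. *)
Lemma boolean_list_cat w1 w2 b N s1 s2 :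
  last b w1 = b -> head (~~ b) w2 = ~~ b ->
  expands B w1 N s1 -> expands B w2 N s2 ->
  psi (prodl s1 * prodl s2) = psi (prodl s1) * psi (prodl s2).
Proof.
move=> lb hb [L1 A1 _ _ E1] [L2 A2 _ E2 _].
case: s1 L1 A1 E1 => [|c s1] L1 A1 E1.
  by rewrite /prodl big_nil psi1 !mul1r.
case: s2 L2 A2 E2 => [|d s2] L2 A2 E2.
  by rewrite /prodl big_nil psi1 !mulr1.
rewrite -prodl_cat !psi_list ?big_cat //; first exact: letters_cat.
rewrite /alt /unzip1 map_cat /= cat_path; apply/andP; split=> //=.
apply/andP; split=> //; apply/eqP => e.
move: (E1 b) (E2 (~~ b)).
rewrite lb hb /top_letters /= (last_map (eq_op^~ N) _ c.1) /unzip1 e => ->.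
by case: (b).
Qed.

Lemma boolean_split w1 w2 b N : last b w1 = b -> head (~~ b) w2 = ~~ b ->
  psi (word x w1 N * word x w2 N) = psi (word x w1 N) * psi (word x w2 N).
Proof.
move=> lb hb.
apply: (eq_span (f := fun y => psi (y * word x w2 N))
  (g := fun y => psi y * psi (word x w2 N))) (word_span BM Bx w1 N).
- by move=> u v; rewrite mulrDl raddfD.
- by move=> u v; rewrite raddfD mulrDl.
move=> _ [s1 -> h1].
apply: (eq_span (f := fun y => psi (prodl s1 * y))
  (g := fun y => psi (prodl s1) * psi y)) (word_span BM Bx w2 N).
- by move=> u v; rewrite mulrDr raddfD.
- by move=> u v; rewrite raddfD mulrDr.
by move=> _ [s2 -> h2]; exact: boolean_list_cat lb hb h1 h2.
Qed.

Lemma boolean_runs a b c N : psi (psum x N ^+ a * x N ^+ b.+1 * psum x N ^+ c)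
  = psi (psum x N ^+ a) * psi (x N ^+ b.+1) * psi (psum x N ^+ c).
Proof.
have last_run b' n : last b' (nseq n b') = b' by elim: n.
have h : psi (x N ^+ b.+1 * psum x N ^+ c)
    = psi (x N ^+ b.+1) * psi (psum x N ^+ c).
  have := @boolean_split (nseq b.+1 true) (nseq c false) true N.
  by rewrite !word_nseq; apply; [exact: last_run | case: (c)].
rewrite -mulrA -[RHS]mulrA -h.
have := @boolean_split (nseq a false) (nseq b.+1 true ++ nseq c false) false N.
by rewrite word_cat !word_nseq; apply.
Qed.

Lemma boolean_mean0 a b N : psi (psum x N ^+ a * x N * psum x N ^+ b) = 0.
Proof.
by have := boolean_runs a 0 b N; rewrite expr1 xmean mulr0 mul0r.
Qed.

(** For c > 0 the first [x] is a run by itself and contributes its mean, which is zero. For c = 0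
    the run x^2 separates the two powers of T, so a product of two moments remains. *)
Lemma boolean_pair a c d N :
  psi (psum x N ^+ a * x N * psum x N ^+ c * x N * psum x N ^+ d)
  = if c is 0%N then
      psi (x 0%N ^+ 2) * (psi (psum x N ^+ a) * psi (psum x N ^+ d))
    else 0.
Proof.
case: c => [|c].
  have := boolean_runs a 1 d N; rewrite same_moments => h.
  by rewrite expr0 mulr1 -[_ * x N * x N]mulrA -expr2 h mulrCA mulrA.
have := @boolean_split (nseq a false ++ [:: true])
  (nseq c.+1 false ++ true :: nseq d false) true N.
rewrite !(word_cat, word_cons, word_nseq, word0) mulr1 !mulrA => -> //.
  by have := boolean_mean0 a 0 N; rewrite expr0 mulr1 => ->; rewrite mul0r.
by rewrite last_cat.
Qed.

(** The first run factors out: a run of [x N] gives a constant, a run of [psum x N] a lower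
    moment. *)
Lemma boolean_weight_words k : weight_word_below psi x k.
Proof.
move=> hM w; have [m] := ubnP (size w); elim: m => // m IH in w *.
case: w => [|b w].
  by move=> _ _; apply: eq_weight (weight_const 0 1) => n; rewrite word0 psi1.
have [n [w2 [-> hw2]]] := run_split b w.
rewrite size_cat size_nseq count_cat count_nseq => lt_m lt_k.
have lw2 := IH w2 _ _.
have : weight (~~ b * n.+1) (fun N => psi (word x (nseq n.+1 b) N)).
  case: b {hw2} lt_k => /= lt_k.
    apply: eq_weight (weight_const _ (psi (x 0%N ^+ n.+1))) => N.
    by rewrite (word_nseq x true n.+1) same_moments.
  rewrite mul1n; apply: eq_weight (hM n.+1 _) => [N|]; last by lia.
  by rewrite (word_nseq x false n.+1).
move=> /weightM h; apply: eq_weight (h _ _ (lw2 _ _)) => [N||]; try lia.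
by rewrite word_cat (@boolean_split _ _ b) //; elim: (n).
Qed.

(** The binomial of [leadM] times (a/2)! (d/2)! is p!. The p + 1 even values of [a] then add up to
    (p + 1)!, that is, g_(p+1) = 1. *)
Definition boolean_kappa a c d :=
  if (c == 0)%N && ~~ odd a then ((a + d)./2)`! else 0%N.

Theorem boolean_lead : (forall k, weight k (moment psi x k))
  /\ forall p, lead p (psi (x 0%N ^+ 2) ^+ p *+ p`!) (moment psi x p.*2).
Proof.
apply: (lead_moment psi1 boolean_mean0 boolean_weight_words
  (G := factorial) (kappa := boolean_kappa)) => // p.
  rewrite big_ord_recr /= subnn big_ord0 addn0 factS -sum_even.
  apply: eq_bigr => a _ /=; have le_a : (a <= p.*2)%N by rewrite -ltnS.
  rewrite subSn // big_ord_recl big1 // addn0 /= subn0.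
  by rewrite /boolean_kappa /= subnKC ?doubleK.
move=> hq hw a c d eacd.
apply: eq_lead (fun N => esym (boolean_pair a c d N)) _.
rewrite /boolean_kappa; case: c eacd => [|c] eacd; last first.
  by rewrite mulr0n; apply: lead0.
have ead : (a + d = p.*2)%N by lia.
rewrite eqxx ead doubleK /= exprS -mulrnAr; apply: leadZ.
have := lead_moment_mul hq (fun j lt => hw j (leqW lt)) ead.
case odd_a: (odd a) => //= h; have := odd_double_half a; rewrite odd_a => ea.
rewrite (_ : p`! = 'C(p, a./2) * (a./2`! * d./2`!))%N //.
by rewrite (_ : d./2 = p - a./2)%N ?bin_fact //; lia.
Qed.

End Boolean.

Section Monotone.
Hypothesis psi_list : list_monotone.

Lemma last_lt w N s : expands B w N s -> last false w = false ->
  s != [::] -> (last N (unzip1 s) < N)%N.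
Proof.
case: s => // c s [_ _ les _ E] lw _; rewrite ltn_neqAle.
have := E false; rewrite lw /top_letters /= (last_map (eq_op^~ N) _ c.1) => ->.
by apply: (allP les); rewrite /= mem_last.
Qed.

Lemma head_lt w N s : expands B w N s -> head false w = false ->
  s != [::] -> (head N (unzip1 s) < N)%N.
Proof.
case: s => // c s [_ _ les E _] hw _; rewrite ltn_neqAle /=.
have := E false; rewrite hw /top_letters /= => ->.
by apply: (allP les); rewrite /= mem_head.
Qed.

(** The newest variable has the largest index, so each run of [x N] is a peak, whatever the letters
    of index below [N] around it. *)
Lemma monotone_split w1 w2 b N :
  last false w1 = false -> head false w2 = false ->
  psi (word x w1 N * x N ^+ b.+1 * word x w2 N)
  = psi (x N ^+ b.+1) * psi (word x w1 N * word x w2 N).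
Proof.
move=> lw hw.
apply: (eq_span (f := fun y => psi (y * x N ^+ b.+1 * word x w2 N))
  (g := fun y => psi (x N ^+ b.+1) * psi (y * word x w2 N)))
  (word_span BM Bx w1 N).
- by move=> u v; rewrite !mulrDl raddfD.
- by move=> u v; rewrite mulrDl raddfD mulrDr.
move=> _ [s1 -> h1].
apply: (eq_span (f := fun y => psi (prodl s1 * x N ^+ b.+1 * y))
  (g := fun y => psi (x N ^+ b.+1) * psi (prodl s1 * y)))
  (word_span BM Bx w2 N).
- by move=> u v; rewrite mulrDr raddfD.
- by move=> u v; rewrite mulrDr raddfD mulrDr.
move=> _ [s2 -> h2]; apply: (psi_list (i := N)); last exact: head_lt h2 hw.
- by case: h1.
- by case: h2.
- exact: BXn.
- exact: last_lt h1 lw.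
Qed.

Let last_nseqF n : last false (nseq n false) = false.
Proof. by elim: n. Qed.

Lemma monotone_mean0 a b N : psi (psum x N ^+ a * x N * psum x N ^+ b) = 0.
Proof.
have := @monotone_split (nseq a false) (nseq b false) 0 N (last_nseqF a).
by rewrite !word_nseq expr1 xmean mul0r; apply; case: (b).
Qed.

(** For c = 0 removing the peak x^2 joins the two powers of T, in contrast to the Boolean case. For
    c > 0 the first [x] is a peak of mean zero. *)
Lemma monotone_pair a c d N :
  psi (psum x N ^+ a * x N * psum x N ^+ c * x N * psum x N ^+ d)
  = if c is 0%N then psi (x 0%N ^+ 2) * psi (psum x N ^+ (a + d)) else 0.
Proof.
case: c => [|c].
  have := @monotone_split (nseq a false) (nseq d false) 1 N (last_nseqF a).
  rewrite !word_nseq expr0 mulr1 -[_ * x N * x N]mulrA -expr2 -exprD.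
  by rewrite same_moments; apply; case: (d).
have := @monotone_split (nseq a false)
  (nseq c.+1 false ++ true :: nseq d false) 0 N (last_nseqF a).
rewrite !(word_cat, word_cons, word_nseq, word0) !mulrA expr1 => -> //.
by rewrite xmean mul0r.
Qed.

Lemma monotone_weight_words k : weight_word_below psi x k.
Proof.
move=> hM w; have [m] := ubnP (size w); elim: m => // m IH in w *.
(* The first run of [x N] is a peak. Pulling it out as a constant leaves a shorter word with the
   same letters [psum x N]. *)
have [a [b [w2 [ew hw2]]]] : exists a b w2,
    w = nseq a false ++ nseq b true ++ w2
    /\ (w2 != [::] -> (0 < b)%N /\ head false w2 = false).
  case: w => [|b w]; first by exists 0%N, 0%N, [::].
  have [n [w2 [-> hw2]]] := run_split b w; case: b hw2 => /= hw2.
    by exists 0%N, n.+1, w2; split=> //; case: (w2) hw2.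
  case: w2 hw2 => [|b w2] /= hw2; first by exists n.+1, 0%N, [::].
  subst b; have [n' [w3 [-> hw3]]] := run_split true w2.
  by exists n.+1, n'.+1, w3; split=> //; case: (w3) hw3.
case: b ew hw2 => [|b] -> hw2.
  have -> : w2 = [::] by case: w2 hw2 => // b w2 [].
  rewrite /= cats0 count_nseq /= mul1n => _ lt_k.
  by apply: eq_weight (hM a lt_k) => N; rewrite word_nseq.
rewrite !(size_cat, size_nseq, count_cat, count_nseq) /= => lt_m lt_k.
have := IH (nseq a false ++ w2); rewrite size_cat size_nseq count_cat count_nseq.
move=> h; have {}h := h ltac:(lia) ltac:(lia).
apply: eq_weight (weightZ (psi (x 0%N ^+ b.+1)) h) => N.
rewrite -[true :: _]/(nseq b.+1 true ++ w2) !word_cat mulrA !word_nseq.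
rewrite -(same_moments N).
have := @monotone_split (nseq a false) w2 b N (last_nseqF a).
rewrite !word_nseq => -> //.
by case: w2 hw2 {lt_m lt_k h} => // c w2 [].
Qed.

(** This is (2p - 1)!!. The factor 2q + 1 counts the positions a = 0, ..., 2q of an adjacent pair of
    letters x, all with the same contribution. *)
Fixpoint odd_factorial p := if p is q.+1 then (q.*2.+1 * odd_factorial q)%N else 1%N.

Theorem monotone_lead : (forall k, weight k (moment psi x k))
  /\ forall p, lead p (psi (x 0%N ^+ 2) ^+ p *+ odd_factorial p) (moment psi x p.*2).
Proof.
apply: (lead_moment psi1 monotone_mean0 monotone_weight_words
  (kappa := fun a c d => if c is 0%N then odd_factorial (a + d)./2 else 0%N)) => // p.
  rewrite big_ord_recr /= subnn big_ord0 addn0 /=.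
  rewrite -[in LHS](subn0 p.*2.+1) -sum_nat_const_nat.
  rewrite big_mkord; apply: eq_bigr => a _.
  have le_a : (a <= p.*2)%N by rewrite -ltnS.
  by rewrite subSn // big_ord_recl big1 // addn0 /= subn0 subnKC ?doubleK.
move=> hq hw a c d eacd.
apply: eq_lead (fun N => esym (monotone_pair a c d N)) _.
case: c eacd => [|c] eacd; last by rewrite mulr0n; apply: lead0.
have ead : (a + d = p.*2)%N by lia.
by rewrite ead doubleK exprS -mulrnAr; apply: leadZ; apply: hq.
Qed.

End Monotone.

End BooleanMonotone.

(** * Catalan numbers *)

Section Catalan.
Local Open Scope nat_scope.

(** The ballot form gives an integer without division, and the subtraction is never truncated. *)
Definition catalan n := 'C(n.*2, n) - 'C(n.*2, n.+1).

Lemma mul_catalan n : n.+1 * catalan n = 'C(n.*2, n).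
Proof.
rewrite /catalan mulnBr mul_bin_left -addnn addnK mulSn.
by rewrite addnK.
Qed.

Lemma central_binS n : n.+1 * 'C(n.+1.*2, n.+1) = n.*2.+1.*2 * 'C(n.*2, n).
Proof.
have h1 := mul_bin_diag n.+1.*2 n; have h2 := mul_bin_down n.*2.+1 n.
rewrite /= in h1 h2; have e : n.*2.+1 - n = n.+1 by lia.
rewrite -h1 -(doubleMl n.*2.+1) h2 e doubleS /=; lia.
Qed.

Lemma catalanS n : n.+2 * catalan n.+1 = n.*2.+1.*2 * catalan n.
Proof.
apply/eqP; rewrite -(eqn_pmul2l (ltn0Sn n)) mul_catalan central_binS.
by rewrite -mul_catalan mulnCA.
Qed.

(** Under the reflection of [q] to [n - q] the mean value of the factor [q] is n / 2. *)
Lemma sum_symmetric (c : nat -> nat) n :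
  (\sum_(q < n.+1) q * (c q * c (n - q))).*2
  = n * \sum_(q < n.+1) c q * c (n - q).
Proof.
rewrite -addnn {2}(reindex_inj rev_ord_inj) /= -big_split big_distrr /=.
apply: eq_bigr => q _; have le_q : q <= n by rewrite -ltnS.
by rewrite subSS subKn // (mulnC (c (n - q))) -mulnDl subnKC.
Qed.

(** The sum T m of (q + 1) C_q C_(m-q) is computed twice. By symmetry 2 T m is m + 2 times the
    convolution; by the two-term recursion [catalanS] and the induction hypothesis T (n + 1) = (2n +
    3) C_(n+1). Comparing with [catalanS] gives C_(n+2). *)
Lemma catalan_conv n : catalan n.+1 = \sum_(q < n.+1) catalan q * catalan (n - q).
Proof.
elim: n => [|n IH]; first by rewrite big_ord1.
pose T m := \sum_(q < m.+1) q.+1 * (catalan q * catalan (m - q)).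
have T2 m : (T m).*2 = m.+2 * \sum_(q < m.+1) catalan q * catalan (m - q).
  rewrite /T; under eq_bigr do rewrite mulSn.
  by rewrite big_split doubleD /= sum_symmetric -mul2n -mulnDl.
have TS : T n.+1 = n.*2.+3 * catalan n.+1.
  rewrite /T big_ord_recl /= subn0 mul1n {1}/catalan /= mul1n.
  under eq_bigr => q _ do rewrite /bump leq0n add1n mulnA catalanS subSS.
  have -> : \sum_(q < n.+1) q.*2.+1.*2 * catalan q * catalan (n - q)
      = (\sum_(q < n.+1) q * (catalan q * catalan (n - q))).*2.*2
        + (\sum_(q < n.+1) catalan q * catalan (n - q)).*2.
    rewrite -!muln2 !big_distrl -big_split /=.
    by apply: eq_bigr => q _; rewrite -!muln2; lia.
  by rewrite sum_symmetric -IH -!muln2; lia.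
apply/eqP; rewrite -(eqn_pmul2l (ltn0Sn n.+2)) catalanS -T2 TS; apply/eqP.
by rewrite -!muln2; lia.
Qed.

Lemma sum_triangle (F : nat -> nat) n :
  \sum_(a < n.+1) \sum_(c < n - a) F c = \sum_(c < n) (n - c) * F c.
Proof.
elim: n => [|n IH]; first by rewrite big_ord1 !big_ord0.
rewrite big_ord_recl subn0; under [X in _ + X]eq_bigr do rewrite subSS.
rewrite IH [RHS]big_ord_recr big_ord_recr /= subSn // subnn mul1n addnAC.
congr (_ + _); rewrite -big_split; apply: eq_bigr => c _ /=.
by rewrite subSn ?(ltnW (ltn_ord c)) // mulSn.
Qed.

Lemma sum_even_only (F : nat -> nat) p :
  \sum_(c < p.*2.+1) (if odd c then 0 else F c) = \sum_(q < p.+1) F q.*2.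
Proof.
elim: p => [|p IH]; first by rewrite !big_ord1.
rewrite doubleS 2!big_ord_recr IH [RHS]big_ord_recr /= !odd_double /=.
by rewrite addn0.
Qed.

Definition free_kappa a c d :=
  if odd c then 0 else
  'C((a + c + d)./2, c./2)
  * ((c./2)`! * catalan c./2 * ((a + d)./2`! * catalan (a + d)./2)).

(** A value c = 2q occurs for 2p + 1 - 2q values of [a]. Under the reflection of q to p - q this
    multiplicity averages to p + 1, which leaves (p + 1) p! times the Catalan convolution. *)
Lemma free_kappa_sum p : p.+1`! * catalan p.+1 =
  \sum_(a < p.*2.+2) \sum_(c < p.*2.+1 - a) free_kappa a c (p.*2 - a - c).
Proof.
pose F c := if odd c then 0 else p`! * (catalan c./2 * catalan (p - c./2)).
rewrite (eq_bigr (fun a : 'I_p.*2.+2 => \sum_(c < p.*2.+1 - a) F c)) => [|a _].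
  rewrite (sum_triangle F).
  pose H c := (p.*2.+1 - c) * (p`! * (catalan c./2 * catalan (p - c./2))).
  rewrite (eq_bigr (fun c : 'I_p.*2.+1 => if odd c then 0 else H c)) => [|c _].
    rewrite sum_even_only factS catalan_conv.
    set S := \sum_(q < p.+1) catalan q * catalan (p - q).
    have hS : _ = p * S := sum_symmetric catalan p.
    suff: \sum_(q < p.+1) H q.*2 + p`! * (p * S) = p.*2.+1 * (p`! * S) by lia.
    rewrite -hS -muln2 !(big_distrl, big_distrr) -big_split.
    apply: eq_bigr => q _ /=; rewrite /H doubleK.
    have lt_q := ltn_ord q; rewrite -[in RHS](@subnK q.*2 p.*2.+1); last by lia.
    lia.
  by rewrite /F /H; case: ifP => _; rewrite ?muln0.
apply: eq_bigr => c _; rewrite /free_kappa /F; case: ifPn => // ec.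
have lt_c := ltn_ord c; have ea := even_halfK ec.
have -> : a + c + (p.*2 - a - c) = p.*2 by lia.
have -> : (a + (p.*2 - a - c))./2 = p - c./2.
  by rewrite (_ : _ + _ = (p - c./2).*2) ?doubleK //; lia.
have le_cp : c./2 <= p by lia.
by rewrite doubleK -(bin_fact le_cp); lia.
Qed.

End Catalan.

(** * Free independence *)

Section Free.
Variables (D : comNzRingType) (A : algType D) (psi : {scalar A}).
Variables (B : nat -> A -> Prop) (x : nat -> A).
Hypothesis BM : forall i c d, B i c -> B i d -> B i (c * d).
Hypothesis BD : forall i c d, B i c -> B i d -> B i (c + d).
Hypothesis BZ : forall i k c, B i c -> B i (k *: c).
Hypothesis B1 : forall i, B i 1.
Hypothesis Bx : forall i, B i (x i).
Hypothesis psi1 : psi 1 = 1.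
Hypothesis same_moments : forall i k, psi (x i ^+ k) = psi (x 0%N ^+ k).
Hypothesis mean : psi (x 0%N) = 0.

Definition centered i c := B i c /\ psi c = 0.

Definition list_free := forall s, s != [::] -> letters centered s -> alt s ->
  psi (prodl s) = 0.

Hypothesis psi_list : list_free.

Let xmean i : psi (x i) = 0.
Proof. by have := same_moments i 1; rewrite !expr1 mean. Qed.

Definition center y := y - (psi y)%:A.

Lemma psiA k : psi k%:A = k.
Proof. by rewrite linearZ psi1 /= mulr1. Qed.

Lemma centerK y : y = center y + (psi y)%:A.
Proof. by rewrite subrK. Qed.

Lemma centered_center i y : B i y -> centered i (center y).
Proof.
move=> By; split; last by rewrite /center linearB psiA subrr.
by apply: BD => //; rewrite -scaleNr; apply: BZ.
Qed.

Lemma centered_x i : centered i (x i).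
Proof. by split. Qed.

Definition reduced N y := exists2 s, y = prodl s &
  [/\ letters centered s, alt s, all (fun i => (i < N)%N) (unzip1 s)
    & s != [::]].

Lemma reducedZ N k y : reduced N y -> reduced N (k *: y).
Proof.
case=> -[|[i c] s] -> [] // [[Bc c0] Ls] As ls _; exists ((i, k *: c) :: s).
  by rewrite !prodl_cons scalerAl.
by split=> //; split=> //; split; [apply: BZ | rewrite linearZ /= c0 mulr0].
Qed.

(* With k = psi y: the subalgebra generated by the x i, i < N, is spanned by 1 and
   the alternating products of centered letters. *)
Definition reducible N y := exists k, span (reduced N) (y - k%:A).

Lemma reducible_scalar N k : reducible N k%:A.
Proof. by exists k; rewrite subrr; left. Qed.

Lemma reducible_in N y : reduced N y -> reducible N y.
Proof. by move=> h; exists 0; rewrite scale0r subr0; apply: span_in. Qed.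

Lemma reducibleD N y z : reducible N y -> reducible N z -> reducible N (y + z).
Proof.
move=> [k hk] [l hl]; exists (k + l).
by rewrite scalerDl opprD addrACA; apply: spanD.
Qed.

Lemma reducible_sum N n (F : 'I_n -> A) :
  (forall i, reducible N (F i)) -> reducible N (\sum_(i < n) F i).
Proof.
move=> h; elim/big_rec: _ => [|i y _]; last exact: reducibleD.
by have := reducible_scalar N 0; rewrite scale0r.
Qed.

(** Either [x i] prolongs the alternating word, or the first letter [d] has the same index. Then
    [x i * d] splits into its centered part, which again gives an alternating word, and a scalar,
    which drops the first letter. *)
Lemma reducible_mulx N i y : (i < N)%N -> reducible N y -> reducible N (x i * y).
Proof.
move=> lt_iN [k]; rewrite -{2}[y](subrK k%:A) mulrDr.
move: (y - _) => z hz; apply: reducibleD; last first.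
  rewrite -scalerAr mulr1; apply/reducible_in/reducedZ; exists [:: (i, x i)].
    by rewrite prodl_cons /prodl big_nil mulr1.
  by rewrite /= lt_iN; split=> //; split=> //; apply: centered_x.
elim: hz => [|_ v [s -> [Ls As ls _]] _ IH].
  by rewrite mulr0; have := reducible_scalar N 0; rewrite scale0r.
rewrite mulrDr; apply: reducibleD IH.
case: s Ls As ls => [|[j d] s] Ls As ls.
  apply: reducible_in; exists [:: (i, x i)]; first by rewrite prodl_cons.
  by rewrite /= lt_iN; split=> //; split=> //; apply: centered_x.
have [eij|ne_ij] := eqVneq i j; last first.
  apply: reducible_in; exists ((i, x i) :: (j, d) :: s).
    by rewrite [RHS]prodl_cons.
  split=> //; [split=> //; exact: centered_x | by rewrite /alt /= ne_ij|].
  by rewrite /= lt_iN; apply: ls.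
subst j; case: Ls => -[Bd _] Ls.
rewrite prodl_cons mulrA [x i * _]centerK mulrDl; apply: reducibleD.
  apply: reducible_in; exists ((i, center (x i * d)) :: s).
    by rewrite [RHS]prodl_cons.
  split=> //=; split=> //; exact/centered_center/BM.
rewrite -scalerAl mul1r; case: s Ls As ls => [|e s] Ls As ls.
  by rewrite /prodl big_nil; apply: reducible_scalar.
apply/reducible_in/reducedZ; exists (e :: s) => //; split=> //.
  by move: As; rewrite /alt /= => /andP[].
by move: ls => /= /andP[].
Qed.

Lemma psi_reduced N y : span (reduced N) y -> psi y = 0.
Proof.
elim=> [|_ z [s -> [Ls As _ s0]] _ IH]; first by rewrite linear0.
by rewrite linearD IH psi_list ?addr0.
Qed.

(** The scalar in [reducible] must be psi of the element, since psi vanishes on reduced products. *)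
Lemma center_psum N a : span (reduced N) (center (psum x N ^+ a)).
Proof.
suff [k hk] : reducible N (psum x N ^+ a).
  have /eqP := psi_reduced hk; rewrite linearB psiA subr_eq0 => /eqP e.
  by rewrite /center e.
elim: a => [|a IH].
  by have := reducible_scalar N 1; rewrite scale1r.
by rewrite exprS mulr_suml; apply: reducible_sum => i; apply: reducible_mulx.
Qed.

Definition block N (c : bool * nat) : A :=
  (if c.1 then x N else psum x N) ^+ c.2.

Definition starts N b y := exists2 s, y = prodl s &
  [/\ letters centered s, alt s, s != [::] & (head N (unzip1 s) == N) = b].

Lemma Bexp i n : B i (x i ^+ n).
Proof. by elim: n => [|n IH]; rewrite ?expr0 // exprS; apply: BM. Qed.

(** A centered power of [psum x N] expands into alternating products of indices below [N], and a
    centered power of [x N] is one letter of index [N], so alternating blocks join without repeated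
    indices. This expresses that [x N] is free from the earlier variables. *)
Lemma starts_blocks N b e w : sorted (fun b b' => b != b') (b :: unzip1 w) ->
  span (starts N b) (center (block N (b, e)) * \prod_(c <- w) center (block N c)).
Proof.
elim: w => [|[b' e'] w IH] in b e *.
  rewrite big_nil mulr1 => _; case: b; rewrite /block /=.
    apply: span_in; exists [:: (N, center (x N ^+ e))].
      by rewrite prodl_cons /prodl big_nil mulr1.
    split=> //=; last by rewrite eqxx.
    by split=> //; apply/centered_center/Bexp.
  elim: (center_psum N e) => [|_ v [s -> [Ls As ls s0]] _ hv]; first by left.
  apply: spanD hv; apply: span_in; exists s => //; split=> //.
  by case: s s0 ls {Ls As} => //= c s _ /andP[/ltn_eqF -> _].
move=> /= /andP[ne sw]; have := IH b' e' sw.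
rewrite big_cons; move: (_ * _) => y hy.
case: b ne => ne; rewrite /block /=.
  apply: span_mull hy => _ [s -> [Ls As s0 hs]].
  apply: span_in; exists ((N, center (x N ^+ e)) :: s).
    by rewrite [RHS]prodl_cons.
  split=> //=; last by rewrite eqxx.
    by split=> //; apply/centered_center/Bexp.
  move: As s0 hs; case: s {Ls} => //= d s; rewrite /alt /= => -> _ hs.
  by rewrite eq_sym hs; move: ne; case: (b').
elim: (center_psum N e) => [|_ v [s -> [Ls As ls s0]] _ hv].
  by rewrite mul0r; left.
rewrite mulrDl; apply: spanD hv.
apply: span_mull hy => _ [s' -> [Ls' As' s0' hs']].
apply: span_in; exists (s ++ s'); first by rewrite prodl_cat.
case: s Ls As ls s0 => // c s Ls As ls _; case: s' Ls' As' s0' hs' => // d s'.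
move=> Ls' As' _ hs'; split=> //.
- exact: letters_cat.
- rewrite /alt /unzip1 map_cat /= cat_path; apply/andP; split=> //=.
  apply/andP; split=> //; apply/eqP => ed.
  have := allP ls (last c.1 (unzip1 s)); rewrite mem_last /unzip1 ed.
  move: ne hs' => /=; case: (b') => // _ /eqP -> /(_ isT).
  by rewrite ltnn.
- by move: ls => /= /andP[/ltn_eqF -> _].
Qed.

Lemma free_blocks N w : w != [::] -> sorted (fun b b' => b != b') (unzip1 w) ->
  psi (\prod_(c <- w) center (block N c)) = 0.
Proof.
case: w => // -[b e] w _ /(starts_blocks N e); rewrite big_cons.
elim=> [|_ z [s -> [Ls As s0 _]] _ IH]; first by rewrite linear0.
by rewrite linearD IH psi_list ?addr0.
Qed.

Local Notation T N := (psum x N).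

Lemma center_x N : center (x N) = x N.
Proof. by rewrite /center xmean scale0r subr0. Qed.

(** The outer powers need not be centered: writing each as centered part plus scalar leaves four
    terms, one for each hypothesis. *)
Lemma psi_surround N a d y :
  psi y = 0 -> psi (center (T N ^+ a) * y) = 0 ->
  psi (y * center (T N ^+ d)) = 0 ->
  psi (center (T N ^+ a) * (y * center (T N ^+ d))) = 0 ->
  psi (T N ^+ a * y * T N ^+ d) = 0.
Proof.
move=> h0 h1 h2 h3; rewrite [T N ^+ a]centerK [T N ^+ d]centerK.
have expand (u v : A) k l : (u + k%:A) * y * (v + l%:A)
    = u * (y * v) + l *: (u * y) + k *: (y * v) + (k * l) *: y.
  rewrite mulrDr -scalerAr mulr1 !mulrDl -scalerAl mul1r -scalerAl -scalerA.
  by rewrite mulrA [k *: (l *: y)]scalerA mulrC -scalerA scalerDr addrACA addrA.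
by rewrite expand !linearD !linearZ /= h0 h1 h2 h3 !mulr0 !addr0.
Qed.

Lemma free_mean0 a d N : psi (T N ^+ a * x N * T N ^+ d) = 0.
Proof.
have h w := @free_blocks N w.
have := h [:: (false, a); (true, 1); (false, d)] isT isT.
have := h [:: (true, 1); (false, d)] isT isT.
have := h [:: (false, a); (true, 1)] isT isT.
rewrite !big_cons !big_nil !mulr1 /block /= expr1 center_x => h1 h2 h3.
exact: psi_surround.
Qed.

(** Centering first T^c and then x^2 leaves the scalar term psi (T^c) psi (x^2) T^(a+d). The other
    two terms have a centered alternating core and vanish. *)
Lemma free_pair a c d N :
  psi (T N ^+ a * x N * T N ^+ c * x N * T N ^+ d)
  = psi (x 0%N ^+ 2) * (psi (T N ^+ c) * psi (T N ^+ (a + d))).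
Proof.
have h w := @free_blocks N w.
have -> : T N ^+ a * x N * T N ^+ c * x N * T N ^+ d
    = T N ^+ a * (x N * center (T N ^+ c) * x N) * T N ^+ d
      + psi (T N ^+ c) *: (T N ^+ a * center (x N ^+ 2) * T N ^+ d)
      + (psi (T N ^+ c) * psi (x N ^+ 2)) *: T N ^+ (a + d).
  have expand (u v z t : A) k m : u * z * (t + k%:A) * z * v
      = u * (z * t * z) * v + k *: (u * (z ^+ 2 - m%:A) * v) + (k * m) *: (u * v).
    rewrite mulrDr !mulrDl -scalerAr mulr1 -!scalerAl !mulrA -addrA; congr (_ + _).
    rewrite mulrBr mulrBl -scalerAr mulr1 -scalerAl -scalerA -scalerDr subrK.
    by rewrite expr2 !mulrA.
  by rewrite [in LHS](centerK (T N ^+ c)) (expand _ _ _ _ _ (psi (x N ^+ 2))) -exprD.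
rewrite !linearD !linearZ /=.
have -> : psi (T N ^+ a * (x N * center (T N ^+ c) * x N) * T N ^+ d) = 0.
  have := h [:: (true, 1); (false, c); (true, 1)] isT isT.
  have := h [:: (false, a); (true, 1); (false, c); (true, 1)] isT isT.
  have := h [:: (true, 1); (false, c); (true, 1); (false, d)] isT isT.
  have := h [:: (false, a); (true, 1); (false, c); (true, 1); (false, d)] isT isT.
  rewrite !big_cons !big_nil !mulr1 /block /= expr1 center_x !mulrA => *.
  by have := @psi_surround N a d (x N * center (T N ^+ c) * x N); rewrite !mulrA; apply.
have -> : psi (T N ^+ a * center (x N ^+ 2) * T N ^+ d) = 0.
  have := h [:: (true, 2)] isT isT.
  have := h [:: (false, a); (true, 2)] isT isT.
  have := h [:: (true, 2); (false, d)] isT isT.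
  have := h [:: (false, a); (true, 2); (false, d)] isT isT.
  by rewrite !big_cons !big_nil !mulr1 /block /= => *; apply: psi_surround.
by rewrite mulr0 !add0r same_moments mulrA [psi (x 0%N ^+ 2) * _]mulrC.
Qed.

Definition blocks N w := \prod_(c <- w) block N c.

Definition low_degree w := (\sum_(c <- w) if c.1 then 0 else c.2)%N.

Lemma blocks_cons N c w : blocks N (c :: w) = block N c * blocks N w.
Proof. by rewrite /blocks big_cons. Qed.

Lemma blocks_cat N w w' : blocks N (w ++ w') = blocks N w * blocks N w'.
Proof. by rewrite /blocks big_cat. Qed.

Lemma low_degree_cat w w' : low_degree (w ++ w') = (low_degree w + low_degree w')%N.
Proof. by rewrite /low_degree big_cat. Qed.

Lemma low_degree_cons c w :
  low_degree (c :: w) = ((if c.1 then 0 else c.2) + low_degree w)%N.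
Proof. by rewrite /low_degree big_cons. Qed.

Lemma weight_block k c : (forall j, (j < k)%N -> weight j (moment psi x j)) ->
  (low_degree [:: c] < k)%N ->
  weight (low_degree [:: c]) (fun N => psi (block N c)).
Proof.
move=> hM; rewrite /low_degree big_cons big_nil addn0 /block.
case: c => -[] e /= lt; last exact: hM.
by apply: eq_weight (weight_const 0 (psi (x 0%N ^+ e))) => N; rewrite same_moments.
Qed.

(* Replacing the centered blocks of l by the blocks themselves only adds terms
   with fewer blocks, which the induction hypothesis controls. *)
Lemma weight_expand k m l u : (forall j, (j < k)%N -> weight j (moment psi x j)) ->
  (forall w, (size w < m)%N -> (low_degree w < k)%N ->
    weight (low_degree w) (fun N => psi (blocks N w))) ->
  (size (u ++ l) <= m)%N -> (low_degree (u ++ l) < k)%N ->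
  weight (low_degree (u ++ l)) (fun N =>
    psi (blocks N u * \prod_(c <- l) center (block N c)) - psi (blocks N (u ++ l))).
Proof.
move=> hM IH; elim: l => [|c l IHl] in u *.
  move=> _ _; apply: eq_weight (weight_const _ 0) => N.
  by rewrite big_nil cats0 mulr1 subrr.
have e1 : u ++ c :: l = (u ++ [:: c]) ++ l by rewrite -catA.
rewrite !size_cat /= => le_m lt_k.
have h1 := IHl (u ++ [:: c]); rewrite -e1 in h1.
have {}h1 := h1 _ lt_k; rewrite !size_cat /= in h1; have {}h1 := h1 ltac:(lia).
have ed : low_degree (u ++ c :: l) = (low_degree [:: c] + low_degree (u ++ l))%N.
  by rewrite !(low_degree_cat, low_degree_cons) /low_degree big_nil; lia.
rewrite ed in lt_k h1 *.
have h2 := IHl u; rewrite !size_cat in h2.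
have {}h2 := h2 ltac:(lia) ltac:(lia).
have h3 := IH (u ++ l); rewrite size_cat in h3.
have {}h3 := h3 ltac:(lia) ltac:(lia).
have hc := weight_block hM (leq_ltn_trans (leq_addr _ _) lt_k).
(* Centering the block [c] subtracts its psi times the word without [c]: [h1] treats the block
   itself, [h2] and [h3] together the shortened word. *)
apply: eq_weight (weightB h1 (weightM hc (weightD h2 h3))) => N.
rewrite subrK big_cons {2}/center mulrBl mulrBr linearB -scalerAl mul1r -scalerAr linearZ.
by rewrite /= blocks_cat {2}/blocks big_seq1 mulrA addrAC.
Qed.

Lemma unsorted_runs (w : seq (bool * nat)) :
  ~~ sorted (fun b b' => b != b') (unzip1 w) ->
  exists w1 b e e' w2, w = w1 ++ (b, e) :: (b, e') :: w2.
Proof.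
elim: w => [|[b e] [|[b' e'] w] IH] //=.
have [->|ne] := eqVneq b b'; first by exists [::], b', e, e', w.
move=> /= /IH [w1 [b0 [e0 [e1 [w2 ->]]]]].
by exists ((b, e) :: w1), b0, e0, e1, w2.
Qed.

(** Neighbouring blocks of the same type merge into a shorter word. If none exist, the fully
    centered product has psi equal to 0, so the difference bounded by [weight_expand] is minus the
    word itself. *)
Lemma free_weight_blocks k w : (forall j, (j < k)%N -> weight j (moment psi x j)) ->
  (low_degree w < k)%N -> weight (low_degree w) (fun N => psi (blocks N w)).
Proof.
move=> hM; have [m] := ubnP (size w); elim: m => // m IH in w *.
rewrite ltnS => le_m lt_k.
have [sw|] := boolP (sorted (fun b b' => b != b') (unzip1 w)); last first.
  move=> /unsorted_runs [w1 [b [e [e' [w2 ew]]]]].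
  have ed : low_degree w = low_degree (w1 ++ (b, e + e')%N :: w2).
    rewrite ew !(low_degree_cat, low_degree_cons) /=.
    by case: (b); rewrite ?addnA.
  rewrite ed in lt_k *; apply: eq_weight (IH _ _ lt_k) => [N|].
    by rewrite ew !(blocks_cat, blocks_cons) /block /= exprD !mulrA.
  by move: le_m; rewrite ew !size_cat /=; lia.
case: w => [|c w] in le_m lt_k sw *.
  by apply: eq_weight (weight_const _ 1) => N; rewrite /blocks big_nil psi1.
have := weight_expand (u := [::]) hM (fun w h => IH w h) le_m lt_k.
move=> /(weightZ (-1)); apply: eq_weight => N.
by rewrite /= /blocks big_nil mul1r free_blocks // mulN1r sub0r opprK.
Qed.

Lemma free_weight_words k : weight_word_below psi x k.
Proof.
move=> hM w lt_k; pose w' := [seq (b, 1%N) | b <- w].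
have ed : low_degree w' = count negb w.
  by rewrite /low_degree big_map -sumn_count sumnE big_map; apply: eq_bigr => -[].
rewrite -ed in lt_k *; apply: eq_weight (free_weight_blocks hM lt_k) => N.
by rewrite /blocks /word big_map.
Qed.

Theorem free_lead : (forall k, weight k (moment psi x k))
  /\ forall p, lead p (psi (x 0%N ^+ 2) ^+ p *+ (p`! * catalan p)) (moment psi x p.*2).
Proof.
apply: (lead_moment psi1 free_mean0 free_weight_words
  (G := fun p => (p`! * catalan p)%N) (kappa := free_kappa)) => // p.
  exact: free_kappa_sum.
move=> hq hw a c d eacd.
apply: eq_lead (fun N => esym (free_pair a c d N)) _.
rewrite exprS -mulrnAr; apply: leadZ.
have := lead_moment_mul hq (fun j le => hw j (leqW le)) (a := c) (d := (a + d)%N).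
by rewrite /free_kappa eacd doubleK; apply; lia.
Qed.

End Free.

(** * Dual numbers *)

(* (a, b) stands for a + b eps, with eps ^ 2 = 0. *)
Definition dual (V : Type) : Type := (V * V)%type.

HB.instance Definition _ (V : zmodType) := GRing.Zmodule.copy (dual V) (V * V)%type.

Section DualRing.
Variable A : nzRingType.
Implicit Types c d e : dual A.

Definition dual_one : dual A := (1, 0).
Definition dual_mul c d : dual A := (c.1 * d.1, c.1 * d.2 + c.2 * d.1).

Lemma dual_mulA : associative dual_mul.
Proof.
move=> c d e; congr pair; rewrite /= ?mulrA //.
by rewrite !mulrDr !mulrDl !mulrA addrA.
Qed.

Lemma dual_mul1 : left_id dual_one dual_mul.
Proof. by case=> a b; congr pair; rewrite /= ?mul1r // mul0r addr0. Qed.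

Lemma dual_mulr1 : right_id dual_one dual_mul.
Proof. by case=> a b; congr pair; rewrite /= ?mulr1 // mulr0 add0r. Qed.

Lemma dual_mulDl : left_distributive dual_mul +%R.
Proof.
by move=> c d e; congr pair; rewrite /= !mulrDl // addrACA.
Qed.

Lemma dual_mulDr : right_distributive dual_mul +%R.
Proof.
by move=> c d e; congr pair; rewrite /= !mulrDr // addrACA.
Qed.

Lemma dual_one_neq0 : dual_one != 0.
Proof. by apply/eqP => -[/eqP]; rewrite oner_eq0. Qed.

HB.instance Definition _ := GRing.Zmodule_isNzRing.Build (dual A)
  dual_mulA dual_mul1 dual_mulr1 dual_mulDl dual_mulDr dual_one_neq0.

End DualRing.

Section DualComRing.
Variable K : comNzRingType.

Lemma dual_mulC : commutative (@dual_mul K).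
Proof.
move=> c d; congr pair; first exact: mulrC.
by rewrite addrC; congr (_ + _); exact: mulrC.
Qed.

HB.instance Definition _ := GRing.PzRing_hasCommutativeMul.Build (dual K) dual_mulC.

End DualComRing.

Section DualAlgebra.
Variables (K : comNzRingType) (A : algType K).

Definition dual_scale (k : dual K) (c : dual A) : dual A :=
  (k.1 *: c.1, k.1 *: c.2 + k.2 *: c.1).

Lemma dual_scaleA k l c : dual_scale k (dual_scale l c) = dual_scale (k * l) c.
Proof.
congr pair; rewrite /= ?scalerA // !scalerDr !scalerDl !scalerA addrA.
by congr (_ + _); rewrite mulrC.
Qed.

Lemma dual_scale1 : left_id 1 dual_scale.
Proof. by case=> a b; congr pair; rewrite /= ?scale1r // scale0r addr0. Qed.

Lemma dual_scaleDr : right_distributive dual_scale +%R.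
Proof. by move=> k c d; congr pair; rewrite /= !scalerDr // addrACA. Qed.

Lemma dual_scaleDl c : {morph dual_scale^~ c : k l / k + l}.
Proof. by move=> k l; congr pair; rewrite /= !scalerDl // addrACA. Qed.

HB.instance Definition _ := GRing.Zmodule_isLmodule.Build (dual K) (dual A)
  dual_scaleA dual_scale1 dual_scaleDr dual_scaleDl.

Lemma dual_scaleAl (k : dual K) (c d : dual A) : k *: (c * d) = (k *: c) * d.
Proof.
congr pair; rewrite /= ?scalerAl // !scalerDr mulrDl !scalerAl.
by rewrite addrA.
Qed.

Lemma dual_scaleAr (k : dual K) (c d : dual A) : k *: (c * d) = c * (k *: d).
Proof.
congr pair; rewrite /= ?scalerAr // !scalerDr mulrDr !scalerAr.
by rewrite -!addrA; congr (_ + _); rewrite addrC.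
Qed.

HB.instance Definition _ := GRing.Lmodule_isLalgebra.Build (dual K) (dual A)
  dual_scaleAl.
HB.instance Definition _ := GRing.Lalgebra_isAlgebra.Build (dual K) (dual A)
  dual_scaleAr.

End DualAlgebra.

Section DualFunctional.
Variables (K : comNzRingType) (A : algType K) (phi phi' : {scalar A}).

Definition dual_pair (c : A) : dual K := (phi c, phi' c).

Lemma dual_pair_additive : {morph dual_pair : x y / x + y}.
Proof. by move=> x y; congr pair; rewrite /= linearD. Qed.

HB.instance Definition _ := GRing.isSemiAdditive.Build A (dual K) dual_pair
  (conj (congr2 pair (linear0 phi) (linear0 phi')) dual_pair_additive).

(** Linearity over the dual numbers forces this extension of [dual_pair]: psi (eps d) = eps phi
    (d). *)
Definition dual_ext (c : dual A) : (dual K)^o :=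
  (phi c.1, phi' c.1 + phi c.2).

Lemma dual_ext_linear : linear dual_ext.
Proof.
move=> k c d; congr pair; rewrite /= !(linearD, linearZ) //=.
rewrite /GRing.scale /=; ring.
Qed.

HB.instance Definition _ := GRing.isLinear.Build (dual K) (dual A) (dual K)^o *%R
  dual_ext dual_ext_linear.

Definition dual_in (a : A) : dual A := (a, 0).

Lemma dual_in_exp a k : dual_in a ^+ k = dual_in (a ^+ k).
Proof.
elim: k => [|k IH] //; rewrite !exprS IH; congr pair => /=.
by rewrite mul0r mulr0 addr0.
Qed.

Lemma dual_ext_in a : dual_ext (dual_in a) = dual_pair a.
Proof. by rewrite /dual_ext /= linear0 addr0. Qed.

Lemma psum_dual_in x N : psum (fun i => dual_in (x i)) N = dual_in (psum x N).
Proof.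
rewrite /psum; elim: N => [|N IH]; first by rewrite !big_ord0.
by rewrite !big_ord_recr /= IH; congr pair; rewrite /= addr0.
Qed.

Lemma moment_dual_in x k :
  moment dual_ext (fun i => dual_in (x i)) k =1 moment dual_pair x k.
Proof.
by move=> N; rewrite /moment psum_dual_in dual_in_exp; exact: dual_ext_in.
Qed.

End DualFunctional.

(** * Infinitesimal independence over the dual numbers *)

Lemma prod_ord_erase0 (A : nzRingType) n (F : 'I_n.+1 -> A) :
  \prod_(l < n.+1 | l != ord0) F l = \prod_(l < n) F (lift ord0 l).
Proof. by rewrite big_mkcond big_ord_recl /= mul1r. Qed.

Lemma prod_ord_eraseS (A : nzRingType) n (F : 'I_n.+1 -> A) (j : 'I_n) :
  \prod_(l < n.+1 | l != lift ord0 j) F l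
  = F ord0 * \prod_(l < n | l != j) F (lift ord0 l).
Proof.
rewrite big_mkcond big_ord_recl /=; congr (_ * _).
by rewrite [RHS]big_mkcond; apply: eq_bigr => l _; rewrite (inj_eq lift_inj).
Qed.

Lemma dual_prod1 (A : nzRingType) n (d : 'I_n -> dual A) :
  (\prod_(j < n) d j).1 = \prod_(j < n) (d j).1.
Proof.
elim: n d => [|n IH] d; first by rewrite !big_ord0.
by rewrite !big_ord_recl /= IH.
Qed.

(** The eps coefficient obeys the Leibniz rule, which is the shape of the second Boolean
    identity. *)
Lemma dual_prod2 (K : comNzRingType) n (d : 'I_n -> dual K) :
  (\prod_(j < n) d j).2
  = \sum_(j < n) (d j).2 * \prod_(l < n | l != j) (d l).1.
Proof.
elim: n d => [|n IH] d; first by rewrite !big_ord0.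
rewrite !big_ord_recl /= IH dual_prod1 prod_ord_erase0 addrC; congr (_ + _).
rewrite big_distrr; apply: eq_bigr => j _ /=.
by rewrite prod_ord_eraseS mulrCA.
Qed.

Section Transfer.
Variables (R : realType) (A : algType R[i]) (phi phi' : {scalar A}).
Variable B : nat -> set A.
Hypothesis phi1 : phi 1 = 1.
Local Notation c0 := (0%N, 0 : A).
Implicit Types s : seq (nat * A).

Lemma prod_nth s n : size s = n ->
  \prod_(j < n) (nth c0 s j).2 = prodl s.
Proof. by move=> <-; rewrite /prodl (big_nth c0) big_mkord. Qed.

Lemma prod_erase s n (j : 'I_n) : size s = n ->
  \prod_(l < n | l != j) (nth c0 s l).2 = prodl (take j s) * prodl (drop j.+1 s).
Proof.
move=> hs; have lt_j : (j < size s)%N by rewrite hs.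
have le_j := ltnW lt_j.
(* Erasing a letter amounts to putting 1 in its place, which keeps the length and the positions. *)
rewrite big_mkcond -[prodl (drop _ _)]mul1r.
rewrite -[1 in RHS]/((0%N, 1 : A).2) -prodl_cons -prodl_cat.
rewrite -(@prod_nth _ n); last first.
  by rewrite size_cat /= size_drop size_takel //; lia.
apply: eq_bigr => l _; rewrite nth_cat size_takel // -val_eqE /=.
case: ltngtP => [lt_lj|lt_jl|->]; last by rewrite subnn.
  by rewrite nth_take.
by rewrite -[(l - j)%N]prednK ?subn_gt0 //= nth_drop; congr (nth _ _ _).2; lia.
Qed.

Lemma letters_nth (P : nat -> A -> Prop) s j : letters P s -> (j < size s)%N ->
  P (nth c0 s j).1 (nth c0 s j).2.
Proof.
by elim: s j => [|c s IH] [|j] //= [hc hs]; [move=> _ | apply: IH].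
Qed.

Lemma alt_nth s n : size s = n -> alt s ->
  @Defs.alternating n (fun j => (nth c0 s j).1).
Proof.
move=> hs /(sortedP 0%N) h j l e.
have := h j; rewrite size_map hs -e ltn_ord => /(_ isT).
rewrite !(nth_map c0) ?hs //; first by move/eqP; rewrite e.
Qed.

Lemma list_boolean_dual :
  inf_boolean phi phi' B -> list_boolean (dual_pair phi phi') B.
Proof.
move=> hB s s0 Ls As.
have [n hn] : exists n, size s = n.+1.
  by case: s s0 {Ls As} => // c s; exists (size s).
have [j|h1 h2] := hB n _ (fun j => (nth c0 s j).2) (alt_nth hn As).
  by apply: letters_nth; rewrite ?hn.
rewrite prod_nth // in h1 h2; rewrite (big_nth c0) big_mkord hn.
apply: injective_projections; first by rewrite dual_prod1.
by rewrite dual_prod2.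
Qed.

Lemma list_monotone_dual :
  inf_monotone phi phi' B -> list_monotone (dual_pair phi phi') B.
Proof.
move=> hM s1 s2 i c L1 L2 Bc h1 h2.
pose s := s1 ++ (i, c) :: s2; pose n := (size s1 + size s2)%N.
have hn : size s = n.+1 by rewrite size_cat /= addnS.
have lt_n : (size s1 < n.+1)%N by rewrite ltnS leq_addr.
have [j ej0] : exists j : 'I_n.+1, j = size s1 :> nat by exists (Ordinal lt_n).
have ej : nth c0 s j = (i, c) by rewrite ej0 nth_cat ltnn subnn.
have [l|l|] := hM n (fun j => (nth c0 s j).1) (fun j => (nth c0 s j).2) j.
- apply: letters_nth; rewrite ?hn //.
  by apply: letters_cat.
- rewrite ej nth_cat ej0 => -[] el.
    have lt_l : (l < size s1)%N by lia.
    have s1n : s1 != [::] by case: (s1) lt_l.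
    rewrite lt_l; have := h1 s1n.
    suff -> : last i (unzip1 s1) = (nth c0 s1 l).1 by [].
    rewrite (_ : nat_of_ord l = (size s1).-1); last by lia.
    by rewrite nth_last; case: (s1) s1n => // d s1' _; rewrite /= (last_map fst _ d).
  have -> : (l < size s1)%N = false by lia.
  rewrite el subSnn /=.
  have lt_l := ltn_ord l; rewrite el /n in lt_l.
  by have := h2; case: (s2) lt_l => [|d s2'] /= => [|_ /(_ isT)] //; lia.
rewrite prod_nth // prod_erase // ej ej0 /= take_size_cat //.
have -> : drop (size s1).+1 s = s2.
  by rewrite /s -cat_rcons drop_size_cat // size_rcons.
rewrite prodl_cat prodl_cons mulrA -prodl_cat => e1 e2.
by congr pair; rewrite //= e2 addrC.
Qed.

Lemma dual_prodl1 (s : seq (nat * dual A)) :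
  (prodl s).1 = prodl [seq (c.1, c.2.1) | c <- s].
Proof.
rewrite /prodl big_map; elim: s => [|c s IH]; first by rewrite !big_nil.
by rewrite !big_cons /= IH.
Qed.

Lemma dual_prodl2 (s : seq (nat * dual A)) :
  (prodl s).2 = \sum_(j < size s)
    (prodl (take j s)).1 * (nth (0%N, 0 : dual A) s j).2.2 * (prodl (drop j.+1 s)).1.
Proof.
elim: s => [|c s IH]; first by rewrite big_ord0 /prodl big_nil.
have prodl0 : prodl [::] = 1 :> dual A by rewrite /prodl big_nil.
rewrite big_ord_recl prodl_cons /= IH mulr_sumr addrC prodl0 mul1r drop0.
by congr (_ + _); apply: eq_bigr => j _; rewrite prodl_cons /= !mulrA.
Qed.

Lemma letters_catE (P : nat -> A -> Prop) s1 s2 :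
  letters P (s1 ++ s2) <-> letters P s1 /\ letters P s2.
Proof. by elim: s1 => [|c s1 IH] /=; [split=> [|[]] | rewrite IH and_assoc]. Qed.

(** For a letter c + eps d, centered means phi (c) = 0 and phi' (c) = - phi (d). The eps coefficient
    of psi of the product is phi' of the product of the c's plus, for each j, phi of the word with
    d_j in place of c_j. Freeness applied to d_j - phi (d_j) 1 turns the latter into phi (d_j) phi
    (word without letter j), which cancels the j-th term of the infinitesimal condition. *)
Lemma list_free_dual : inf_free phi phi' B ->
  (forall i k c, B i c -> B i (c - k%:A)) ->
  list_free (dual_ext phi phi') (fun i c => B i c.1 /\ B i c.2).
Proof.
move=> hF BA s s0 Ls As.
pose C i c := B i c /\ phi c = 0.
have hF1 s' : s' != [::] -> letters C s' -> alt s' -> phi (prodl s') = 0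
    /\ phi' (prodl s') = \sum_(j < size s') phi' (nth c0 s' j).2
         * phi (prodl (take j s') * prodl (drop j.+1 s')).
  move=> s0' Ls' As'.
  have [n hn] : exists n, size s' = n.+1.
    by case: s' s0' {Ls' As'} => // c s' _; exists (size s').
  have lt_size (j : 'I_n.+1) : (j < size s')%N by rewrite hn.
  have [j|j|h1 h2] := hF n _ (fun j => (nth c0 s' j).2) (alt_nth hn As').
  - by have [] := letters_nth Ls' (lt_size j).
  - by have [] := letters_nth Ls' (lt_size j).
  rewrite prod_nth // in h1 h2; split=> //; rewrite h2 hn.
  by apply: eq_bigr => j _; rewrite prod_erase.
pose f (c : nat * dual A) : nat * A := (c.1, c.2.1); pose s' := map f s.
have s0' : s' != [::] by rewrite /s'; case: (s) s0.
have As' : alt s' by rewrite /alt /unzip1 -map_comp.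
have Ls' : letters C s'.
  rewrite /s'; elim: (s) Ls => //= c t IH [[[B1 B2] [e1 e2]] /IH Lt].
  by split.
have [h1 h2] := hF1 s' s0' Ls' As'.
congr pair; rewrite /= dual_prodl1 -/s' ?h1 // h2 dual_prodl2 size_map.
rewrite linear_sum -big_split big1 // => j _ /=.
have lt_j : (j < size s)%N by [].
have es : s = take j s ++ nth (0%N, 0 : dual A) s j :: drop j.+1 s.
  by rewrite -drop_nth // cat_take_drop.
have es' : s' = take j s' ++ nth c0 s' j :: drop j.+1 s'.
  by rewrite -drop_nth ?size_map // cat_take_drop.
have [[[B1 B2] [e1 e2]] Lj] :
    letters (centered (dual_ext phi phi') (fun i c => B i c.1 /\ B i c.2))
      [:: nth (0%N, 0 : dual A) s j].
  by move: Ls; rewrite {1}es; elim: (take j s) => [|c t IH] /= [h ?]; [split|apply: IH].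
rewrite !dual_prodl1 map_take map_drop -/s' (nth_map (0%N, 0 : dual A)) //=.
have en : nth c0 s' j = f (nth (0%N, 0 : dual A) s j) by rewrite (nth_map (0%N, 0 : dual A)).
move: (nth _ s j) B1 B2 e1 e2 {es Lj} en => [i [c d]] /= B1 B2 e1 e2 en.
rewrite {}en /= in es'.
have Lt : letters C (take j s' ++ (i, d - (phi d)%:A) :: drop j.+1 s').
  move: Ls'; rewrite {1}es' !letters_catE /= => -[? [_ ?]]; split=> //; split=> //.
  split; first exact: BA.
  by rewrite linearB linearZ /= phi1 /GRing.scale /= mulr1 subrr.
have [||+ _] := hF1 _ _ Lt.
- by case: (take j s').
- by move: As'; rewrite {1}es' /alt /unzip1 !map_cat.
rewrite prodl_cat prodl_cons /= mulrBl mulrBr linearB mulrA => /eqP.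
rewrite subr_eq0 => /eqP ->.
rewrite -scalerAl mul1r -scalerAr linearZ /= -mulrDl.
by rewrite e2 mul0r.
Qed.

End Transfer.

(** * Limits *)

Section LeadLimit.
Local Open Scope classical_set_scope.
Local Open Scope complex_scope.
Variable R : realType.
Local Notation K := (R[i]).
Implicit Types (f : nat -> K) (c : K).

Lemma lead_pred e f : lead e.+1 0 f -> exists c, lead e c f.
Proof.
elim: e f => [|e IH] f h; last exact: IH h.
exists (f 0%N) => n; elim: n => // n <-.
by apply/eqP; rewrite -subr_eq0; apply/eqP; apply: h.
Qed.

Lemma lead_binomial e : lead e 1 (fun n => 'C(n, e)%:R : K).
Proof.
elim: e => [|e IH]; first by move=> n; rewrite bin0.
by apply: eq_lead IH => n; rewrite /diff binS natrD addrC addKr.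
Qed.

Lemma cvg_real_complex0 (u : nat -> R) :
  u n @[n --> \oo] --> (0 : R) -> (u n)%:C @[n --> \oo] --> (0 : K^o).
Proof.
move=> /(cvgr0Pnorm_lt (V := R)) hu; apply/(cvgr0Pnorm_lt (V := K^o)) => -[e e'].
rewrite ltcE /= => /andP[/eqP -> e0]; have := hu e e0.
by apply: filterS => n; rewrite normc_def /= expr0n addr0 sqrtr_sqr ltcR.
Qed.

Lemma cvg_invn : (n%:R^-1 : R) @[n --> \oo] --> (0 : R).
Proof.
apply/(gtr0_cvgV0 (f := fun n => n%:R)); last exact: cvgr_idn.
by near=> n; rewrite ltr0n; near: n; exact: nbhs_infty_gt.
Unshelve. all: end_near.
Qed.

Lemma cvg_inv_nat : (n%:R^-1 : K) @[n --> \oo] --> (0 : K^o).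
Proof.
have := cvg_real_complex0 cvg_invn.
by under eq_fun do rewrite fmorphV /= rmorph_nat.
Qed.

Lemma cvg_inv_sqrt : ((Num.sqrt (n%:R : R))^-1)%:C @[n --> \oo] --> (0 : K^o).
Proof.
apply: cvg_real_complex0; under eq_fun do rewrite -sqrtrV ?ler0n //.
by rewrite -(sqrtr0 R); apply: continuous_cvg cvg_invn; exact: sqrt_continuous.
Qed.

Lemma cvg_binomial e :
  ('C(n, e)%:R / n%:R ^+ e : K) @[n --> \oo] --> (e`!%:R^-1 : K^o).
Proof.
elim: e => [|e IH].
  under eq_fun do rewrite bin0 expr0 divr1.
  by rewrite invr1; exact: (@cvg_cst K^o).
have h : ('C(n, e)%:R / n%:R ^+ e * ((1 - e%:R * n%:R^-1) / e.+1%:R) : K)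
    @[n --> \oo] --> (e`!%:R^-1 * ((1 - e%:R * 0) / e.+1%:R) : K^o).
  apply: (@cvgM K); first exact: IH.
  apply: (@cvgMr_tmp K); apply: (@cvgB K K^o); first exact: (@cvg_cst K^o).
  by apply: (@cvgMl_tmp K); exact: cvg_inv_nat.
rewrite mulr0 subr0 mul1r -invfM -natrM mulnC -factS in h.
apply: cvg_trans h; apply: near_eq_cvg; near=> n.
have n0 : (0 < n)%N by near: n; exact: nbhs_infty_gt.
have hb : e.+1%:R * 'C(n, e.+1)%:R = (n%:R - e%:R) * 'C(n, e)%:R :> K.
  rewrite -natrM mul_bin_left; have [le_en|lt_ne] := leqP e n.
    by rewrite -natrB // natrM.
  by rewrite bin_small // muln0 mulr0.
have -> : 'C(n, e.+1)%:R = (n%:R - e%:R) * 'C(n, e)%:R / e.+1%:R :> K.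
  by rewrite -hb mulrAC divff ?mul1r // pnatr_eq0.
have n0' : n%:R != 0 :> K by rewrite pnatr_eq0 -lt0n.
have e0 : e.+1%:R != 0 :> K by rewrite pnatr_eq0.
rewrite exprS; have ne0 := expf_neq0 e n0'.
move: (e.+1%:R : K) (n%:R ^+ e : K) ('C(n, e)%:R : K) (n%:R : K) e0 ne0 n0'.
by move=> E P C m E0 P0 m0; field; rewrite E0 P0 m0.
Unshelve. all: end_near.
Qed.

(** Subtracting [c] times a binomial polynomial kills the top difference. The rest has lower degree,
    so by induction it disappears after the extra division by [n]. *)
Lemma cvg_lead e c f : lead e c f ->
  (f n / n%:R ^+ e) @[n --> \oo] --> (c / e`!%:R : K^o).
Proof.
elim: e c f => [|e IH] c f h.
  rewrite divr1; under eq_fun do rewrite h expr0 divr1.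
  exact: (@cvg_cst K^o).
have /lead_pred[c' h'] : lead e.+1 0 (fun n => f n + - c * 'C(n, e.+1)%:R).
  rewrite -[0](subrr c) -{2}[c]mulr1 -mulNr.
  by apply: leadD h _; apply: leadZ; apply: lead_binomial.
have h1 : (c * ('C(n, e.+1)%:R / n%:R ^+ e.+1)
    + (f n + - c * 'C(n, e.+1)%:R) / n%:R ^+ e * n%:R^-1) @[n --> \oo]
    --> (c * (e.+1)`!%:R^-1 + c' / e`!%:R * 0 : K^o).
  apply: (@cvgD K K^o).
    by apply: (@cvgMl_tmp K); exact: cvg_binomial.
  by apply: (@cvgM K); [exact: IH h' | exact: cvg_inv_nat].
rewrite mulr0 addr0 in h1; apply: cvg_trans h1; apply: near_eq_cvg; near=> n.
by rewrite exprSr invfM; ring.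
Unshelve. all: end_near.
Qed.

(** For odd [k] the normalization exceeds the degree bound by half a power, and the leftover factor
    1 / sqrt N tends to 0. *)
Lemma moment_limit (A : algType K) (psi : {scalar A}) (a : nat -> A) k c :
  lead k./2 c (fun N => psi (psum a N ^+ k)) ->
  (psi (normalized_sum a N ^+ k) : K^o) @[N --> \oo]
    --> ((if odd k then 0 else c / (k./2)`!%:R) : K^o).
Proof.
move=> /cvg_lead h.
have e N : psi (normalized_sum a N ^+ k)
    = psi (psum a N ^+ k) / N%:R ^+ k./2
      * (if odd k then ((Num.sqrt (N%:R : R))^-1)%:C else 1).
  rewrite /normalized_sum exprZn linearZ /= mulrC -mulrA; congr (_ * _).
  set x := (_%:C); have x2 : x ^+ 2 = N%:R^-1.
    by rewrite /x -rmorphXn exprVn sqr_sqrtr ?ler0n //= fmorphV /= rmorph_nat.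
  rewrite -[in LHS](odd_double_half k) exprD -mul2n exprM x2 exprVn mulrC.
  by case: odd.
under eq_fun do rewrite e.
case: odd; last by under eq_fun do rewrite mulr1; exact: h.
rewrite -[0](mulr0 (c / (k./2)`!%:R)); apply: (@cvgM K); first exact: h.
exact: cvg_inv_sqrt.
Qed.

End LeadLimit.

(** * Limits of the infinitesimal moments for the three notions *)

Section InfinitesimalLimits.
Local Open Scope classical_set_scope.
Local Open Scope complex_scope.
Variables (R : realType) (A : algType R[i]) (phi phi' : {scalar A}).
Variables (a : nat -> A) (alpha : R[i]).
Hypothesis phi_unit : phi 1 = 1.
Hypothesis phi'_unit : phi' 1 = 0.
Hypothesis same_distr : identically_distributed phi phi' a.
Hypothesis phi_mean : phi (a 0%N) = 0.
Hypothesis phi'_mean : phi' (a 0%N) = 0.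
Hypothesis phi_var : phi (a 0%N ^+ 2) = 1.
Hypothesis phi'_var : phi' (a 0%N ^+ 2) = alpha.
Local Notation psi := (dual_pair phi phi').

Lemma dual_pair_unit : psi 1 = 1.
Proof. by rewrite /dual_pair phi_unit phi'_unit. Qed.

Lemma dual_pair_same i k : psi (a i ^+ k) = psi (a 0%N ^+ k).
Proof. by have [h1 h2] := same_distr i 0 k; congr pair. Qed.

Lemma dual_pair_mean : psi (a 0%N) = 0.
Proof. by rewrite /dual_pair phi_mean phi'_mean. Qed.

Lemma lead_snd (K : comNzRingType) e (c : dual K) f :
  lead e c f -> lead e c.2 (fun n => (f n).2).
Proof. by elim: e f => [|e IH] f h; [move=> n; rewrite h | apply: IH h]. Qed.

Lemma dual_pair_var p : psi (a 0%N ^+ 2) ^+ p = (1, alpha *+ p).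
Proof.
rewrite /dual_pair phi_var phi'_var; elim: p => [|p IH]; first by rewrite expr0.
by rewrite exprS IH; congr pair; rewrite /= !mul1r // mulr1 mulrSr.
Qed.

Lemma infinitesimal_limit (G : nat -> nat) k :
  (forall k, weight k (moment psi a k))
  /\ (forall p, lead p (psi (a 0%N ^+ 2) ^+ p *+ G p) (moment psi a p.*2)) ->
  (phi' (normalized_sum a N ^+ k) : R[i]^o) @[N --> \oo] -->
    ((if odd k then 0
      else alpha * ((k./2)%:R * (G k./2)%:R / (k./2)`!%:R)) : R[i]^o).
Proof.
move=> [hw hl]; have [odd_k|even_k] := boolP (odd k).
  have [c /lead_snd h] := hw k.
  by have := moment_limit h; rewrite odd_k.
have -> : alpha * ((k./2)%:R * (G k./2)%:R / (k./2)`!%:R)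
    = alpha *+ k./2 *+ G k./2 / (k./2)`!%:R.
  by rewrite -mulrnA -(mulr_natr alpha) natrM !mulrA.
have := hl k./2; rewrite even_halfK // dual_pair_var => /lead_snd h.
have := moment_limit h; rewrite (negPf even_k).
suff -> : (((1, alpha *+ k./2) : dual R[i]) *+ G k./2).2 = alpha *+ k./2 *+ G k./2.
  by [].
by elim: (G _) => // n IH; rewrite !mulrSr /= IH.
Qed.

Lemma alg0_self (x : A) : alg0 x x.
Proof. by apply: sub_gen_smallest. Qed.

Lemma alg0_mul (x c d : A) : alg0 x c -> alg0 x d -> alg0 x (c * d).
Proof.
move=> hc hd M [[M1 M2] xM]; apply/set_mem/M2; apply/mem_set; [exact: hc|exact: hd].
Qed.

Lemma alg1_self (x : A) : alg1 x x.
Proof. by apply: sub_gen_smallest. Qed.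

Lemma alg1_closed (x : A) : subalg_closed (mem (alg1 x : set A)).
Proof.
split.
- by apply/mem_set => M [[h1 _ _] _]; apply/set_mem.
- move=> k c d /set_mem hc /set_mem hd; apply/mem_set => M hM.
  by have [[_ h _] _] := hM; apply/set_mem/h; apply/mem_set; [exact: hc|exact: hd].
- move=> c d /set_mem hc /set_mem hd; apply/mem_set => M hM.
  by have [[_ _ h] _] := hM; apply/set_mem/h; apply/mem_set; [exact: hc|exact: hd].
Qed.

Lemma alg0_sub_alg1 (x : A) : alg0 x `<=` alg1 x.
Proof.
move=> c hc; apply: hc; split; last first.
  by move=> _ ->; exact: alg1_self.
have [h1 h2 h3] := alg1_closed x; split=> //; split.
  by have := h2 (-1) 1 1 h1 h1; rewrite scaleN1r addNr.
exact: h2.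
Qed.

Lemma boolean_limit k : inf_boolean phi phi' (fun i => alg0 (a i)) ->
  (phi' (normalized_sum a N ^+ k) : R[i]^o) @[N --> \oo] -->
    ((if odd k then 0 else alpha * (k./2)%:R) : R[i]^o).
Proof.
move=> /list_boolean_dual hB.
have := infinitesimal_limit (k := k) (boolean_lead (fun i => @alg0_mul (a i))
  (fun i => @alg0_self (a i)) dual_pair_unit dual_pair_same dual_pair_mean hB).
by rewrite mulfK // pnatr_eq0 -lt0n fact_gt0.
Qed.

Lemma monotone_limit k :
  inf_monotone phi phi' (fun i => alg1 (a i))
    \/ inf_monotone phi phi' (fun i => alg0 (a i)) ->
  (phi' (normalized_sum a N ^+ k) : R[i]^o) @[N --> \oo] -->
    ((if odd k then 0
      else alpha * ((k./2)%:R * (odd_factorial k./2)%:R / (k./2)`!%:R)) : R[i]^o).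
Proof.
(* [alg0] is contained in [alg1], so the condition over [alg1] implies the one over [alg0]. *)
move=> h; have /list_monotone_dual hM : inf_monotone phi phi' (fun i => alg0 (a i)).
  case: h => // h n i c j hc; exact: h (fun l => alg0_sub_alg1 (hc l)).
exact: (infinitesimal_limit (k := k) (monotone_lead (fun i => @alg0_mul (a i))
  (fun i => @alg0_self (a i)) dual_pair_unit dual_pair_same dual_pair_mean hM)).
Qed.

(* The word (a 1) 1 (a 1), with the middle letter taken in the algebra of a 0. *)
Lemma boolean_alg1_absurd : ~ inf_boolean phi phi' (fun i => alg1 (a i)).
Proof.
move=> /list_boolean_dual hB.
pose s := [:: (1%N, a 1%N); (0%N, 1); (1%N, a 1%N)].
have es : prodl s = a 1%N ^+ 2.
  by rewrite /prodl /s !big_cons big_nil mulr1 /= mul1r expr2.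
have mean1 : psi (a 1%N) = 0.
  by have := dual_pair_same 1 1; rewrite !expr1 dual_pair_mean.
have h : letters (fun i => alg1 (a i)) s -> psi (a 1%N ^+ 2) = 0.
  by move=> Ls; rewrite -es hB // /s !big_cons /= mean1 mul0r.
have /(congr1 fst) : psi (a 0%N ^+ 2) = 0.
  rewrite -(dual_pair_same 1).
  apply: h; split; first exact: alg1_self.
  split; last by split=> //; exact: alg1_self.
  by have [h1 _ _] := alg1_closed (a 0%N); apply/set_mem.
by rewrite /= phi_var => /eqP; rewrite oner_eq0.
Qed.

Lemma free_limit k : inf_free phi phi' (fun i => alg1 (a i)) ->
  (phi' (normalized_sum a N ^+ k) : R[i]^o) @[N --> \oo] -->
    ((if odd k then 0
      else alpha * ((k./2)%:R * (catalan k./2)%:R)) : R[i]^o).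
Proof.
(* This is [alg1 (a i)] extended by eps; it admits dual scalars, as centering requires. *)
move=> hF; pose B i (c : dual A) := alg1 (a i) c.1 /\ alg1 (a i) c.2.
have alg1D i c d : alg1 (a i) c -> alg1 (a i) d -> alg1 (a i) (c + d).
  move=> hc hd; have [_ h _] := alg1_closed (a i).
  by rewrite -[c]scale1r; apply/set_mem/h; apply/mem_set.
have alg11 i : alg1 (a i) 1 by have [h1 _ _] := alg1_closed (a i); apply/set_mem.
have alg10 i : alg1 (a i) 0.
  have [h1 h2 _] := alg1_closed (a i); apply/set_mem.
  by have := h2 (-1) 1 1 h1 h1; rewrite scaleN1r addNr.
have alg1Z i z c : alg1 (a i) c -> alg1 (a i) (z *: c).
  move=> hc; have [_ h _] := alg1_closed (a i).
  by rewrite -[z *: c]addr0; apply/set_mem/h; apply/mem_set.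
have alg1M i c d : alg1 (a i) c -> alg1 (a i) d -> alg1 (a i) (c * d).
  move=> hc hd; have [_ _ h] := alg1_closed (a i).
  by apply/set_mem/h; apply/mem_set.
have hF' : list_free (dual_ext phi phi') B.
  apply: (list_free_dual phi_unit hF) => i z c hc.
  by rewrite -scaleNr; apply: alg1D hc (alg1Z _ _ _ (alg11 i)).
have := @free_lead _ _ (dual_ext phi phi') B (fun i => dual_in (a i)).
case.
- by move=> i c d [c1 c2] [d1 d2]; split; [|apply: alg1D]; apply: alg1M.
- by move=> i c d [c1 c2] [d1 d2]; split; apply: alg1D.
- by move=> i z c [c1 c2]; split; [|apply: alg1D]; apply: alg1Z.
- by move=> i; split.
- by move=> i; split=> //; exact: alg1_self.
- by rewrite -[1]/(dual_in 1) [LHS]dual_ext_in dual_pair_unit.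
- move=> i n; rewrite !dual_in_exp.
  by rewrite [LHS]dual_ext_in [RHS]dual_ext_in dual_pair_same.
- by rewrite [LHS]dual_ext_in dual_pair_mean.
- exact: hF'.
move=> hw hl.
have := @infinitesimal_limit (fun p => (p`! * catalan p)%N) k.
have -> : (k./2)%:R * (catalan k./2)%:R
    = (k./2)%:R * ((k./2)`! * catalan k./2)%:R / (k./2)`!%:R :> R[i].
  by rewrite [(_`! * _)%N]mulnC natrM !mulrA mulfK // pnatr_eq0 -lt0n fact_gt0.
apply; split=> [j|p].
  exact: eq_weight (moment_dual_in _ _ _ _) (hw j).
have := eq_lead (moment_dual_in _ _ _ _) (hl p).
by rewrite dual_in_exp [_ (dual_in _)]dual_ext_in.
Qed.

End InfinitesimalLimits.

Local Open Scope classical_set_scope.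
Local Open Scope ring_scope.

(** * Integrals against charges *)

Section ChargeIntegral.
Variable R : realType.
Local Notation TR := (measurableTypeR R).

(** Domination in the additive form m + m' = m1, as it arises between a Jordan part and a given
    measure on one Hahn set. *)
Lemma integrable_measure_summand d (T : measurableType d)
    (m m' m1 : {measure set T -> \bar R}) (D : set T) (f : T -> \bar R) :
  measurable D ->
  (forall A, measurable A -> A `<=` D -> (m A + m' A = m1 A)%E) ->
  m1.-integrable D f -> m.-integrable D f.
Proof.
move=> mD h /integrableP[mf if1]; apply/integrableP; split=> //.
apply: le_lt_trans if1; have -> : (\int[m1]_(x in D) `|f x| = \int[measure_add m m']_(x in D) `|f x|)%E.
  by apply: eq_measure_integral => A mA AD; rewrite -h // -measure_addE.
rewrite ge0_integral_measure_add //; first by rewrite leeDl // integral_ge0.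
exact: measurableT_comp.
Qed.

Lemma integrable_cover d (T : measurableType d) (m : {measure set T -> \bar R})
    (P N : set T) (f : T -> \bar R) :
  measurable P -> measurable N -> P `|` N = setT -> [disjoint P & N] ->
  m.-integrable P f -> m.-integrable N f -> m.-integrable setT f.
Proof.
move=> mP mN PNT PN /integrableP[mfP iP] /integrableP[mfN iN].
have mf : measurable_fun setT f by rewrite -PNT; apply/measurable_funU.
apply/integrableP; split=> //; rewrite -PNT ge0_integral_setU //.
  exact: lte_add_pinfty.
by rewrite PNT; exact: measurableT_comp.
Qed.

Lemma jordan_integral_diff d (T : measurableType d)
    (nu : {charge set T -> \bar R}) (P N : set T)
    (nuPN : hahn_decomposition nu P N)
    (m1 m2 : {finite_measure set T -> \bar R}) (g : T -> R) :
  (forall X, measurable X -> nu X = (m1 X - m2 X)%E) ->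
  m1.-integrable setT (EFin \o g) -> m2.-integrable setT (EFin \o g) ->
  \int[jordan_pos nuPN]_t g t - \int[jordan_neg nuPN]_t g t
  = \int[m1]_t g t - \int[m2]_t g t.
Proof.
move=> nuE i1 i2.
have [[mP Ppos] [mN Nneg] PNT PN0] := nuPN.
have m1P X : measurable X -> m1 X \is a fin_num by exact: fin_num_measure.
have m2P X : measurable X -> m2 X \is a fin_num by exact: fin_num_measure.
have jpE X : measurable X -> jordan_pos nuPN X = (m1 (X `&` P) - m2 (X `&` P))%E.
  move=> mX; rewrite jordan_posE cjordan_posE /crestr0 mem_set // /crestr nuE //.
  exact: measurableI.
have jnE X : measurable X -> jordan_neg nuPN X = (m2 (X `&` N) - m1 (X `&` N))%E.
  move=> mX; rewrite jordan_negE cjordan_negE /crestr0 mem_set // /crestr nuE //.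
    have m1f := m1P _ (measurableI _ _ mX mN).
    have m2f := m2P _ (measurableI _ _ mX mN).
    by rewrite fin_num_oppeB // addeC.
  exact: measurableI.
have PNd : [disjoint P & N] by apply/disj_setPS; rewrite PN0.
(* On [P] the measure [jordan_pos] plus [m2] is [m1]. On [N] it is null, so adding [m1] to it gives
   [m1]. Thus [m1] dominates it on both halves. *)
have ip : (jordan_pos nuPN).-integrable setT (EFin \o g).
  apply: (integrable_cover mP mN PNT PNd).
    apply: (@integrable_measure_summand _ _ _ m2 m1) => //;
      last exact: (integrableS measurableT).
    by move=> A mA AP; rewrite -[X in (X + _)%E]/(jordan_pos nuPN A) jpE // (setIidl AP) subeK ?m2P.
  apply: (@integrable_measure_summand _ _ _ m1 m1) => //;
      last exact: (integrableS measurableT).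
  move=> A mA AN; rewrite -[X in (X + _)%E]/(jordan_pos nuPN A) jpE // (_ : A `&` P = set0)
    ?measure0 ?sube0 ?add0e //.
  by apply/seteqP; split=> // x [/AN Nx Px]; rewrite -PN0.
have ineg : (jordan_neg nuPN).-integrable setT (EFin \o g).
  apply: (integrable_cover mP mN PNT PNd); last first.
    apply: (@integrable_measure_summand _ _ _ m1 m2) => //;
      last exact: integrableS i2.
    by move=> A mA AP; rewrite -[X in (X + _)%E]/(jordan_neg nuPN A) jnE // (setIidl AP) subeK ?m1P.
  apply: (@integrable_measure_summand _ _ _ m2 m2) => //;
      last exact: integrableS i2.
  move=> A mA AN; rewrite -[X in (X + _)%E]/(jordan_neg nuPN A) jnE // (_ : A `&` N = set0)
    ?measure0 ?sube0 ?add0e //.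
  by apply/seteqP; split=> // x [/AN Nx Px]; rewrite -PN0.
have mg : measurable_fun setT (EFin \o g) by case/integrableP: i1.
(* Hence jordan_pos + m2 and jordan_neg + m1 are the same measure. *)
have jordanE A : measurable A ->
    (jordan_pos nuPN A + m2 A = jordan_neg nuPN A + m1 A)%E.
  move=> mA.
  have : (nu A = jordan_pos nuPN A - jordan_neg nuPN A)%E.
    by rewrite (jordan_decomp nuPN mA) /cadd /= /cscale EFinN mulN1e.
  rewrite nuE //.
  have jpf : jordan_pos nuPN A \is a fin_num by exact: fin_num_measure.
  have jnf : jordan_neg nuPN A \is a fin_num by exact: fin_num_measure.
  move: (m1P A mA) (m2P A mA) jpf jnf.
  move: (m1 A) (m2 A) (jordan_pos nuPN A) (jordan_neg nuPN A).
  move=> [a| |] [b| |] [c| |] [e| |] // _ _ _ _.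
  by rewrite -!EFinN -!EFinD => -[h]; congr EFin; lra.
have e : (\int[measure_add (jordan_pos nuPN) m2]_x (EFin \o g) x
    = \int[measure_add (jordan_neg nuPN) m1]_x (EFin \o g) x)%E.
  apply: eq_measure_integral => A mA _.
  by rewrite [LHS]measure_addE [RHS]measure_addE; exact: jordanE.
rewrite !integral_measure_add // in e; move/(congr1 fine): e.
have f1 := integrable_fin_num measurableT i1.
have f2 := integrable_fin_num measurableT i2.
have fp := integrable_fin_num measurableT ip.
have fn := integrable_fin_num measurableT ineg.
rewrite (fineD fp f2) (fineD fn f1) => e.
by rewrite /Rintegral; move: e => /=; lra.
Qed.

Lemma charge_integral_diff (nu : {charge set TR -> \bar R})
    (m1 m2 : {finite_measure set TR -> \bar R}) (g : R -> R) :
  (forall X, measurable X -> nu X = (m1 X - m2 X)%E) ->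
  m1.-integrable setT (EFin \o g) -> m2.-integrable setT (EFin \o g) ->
  charge_integral nu g = \int[m1]_t g t - \int[m2]_t g t.
Proof. exact: jordan_integral_diff. Qed.

End ChargeIntegral.

(** * Measures and charges given by a density *)

Section DensityMeasure.
Context d (T : measurableType d) (R : realType).
Variables (mu : {sigma_finite_measure set T -> \bar R}) (h : T -> R).
Hypothesis ih : mu.-integrable setT (EFin \o h).
Hypothesis h0 : forall x, 0 <= h x.

Lemma induced_charge_ge0 E : (0 <= induced_charge ih E)%E.
Proof. by apply: integral_ge0 => x _ /=; rewrite lee_fin. Qed.

Definition density_measure : set T -> \bar R := measure_of_charge _ induced_charge_ge0.

HB.instance Definition _ := Measure.on density_measure.

Lemma density_measureE A : density_measure A = (\int[mu]_(x in A) (h x)%:E)%E.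
Proof. by []. Qed.

Let fin_density : fin_num_fun density_measure.
Proof. by move=> A mA; exact: (fin_num_measure (induced_charge ih)). Qed.

HB.instance Definition _ := @Measure_isFinite.Build _ _ _ density_measure fin_density.

Let mh : measurable_fun setT (EFin \o h).
Proof. by case/integrableP: ih. Qed.

Lemma density_dominates : density_measure `<< mu.
Proof.
apply/null_content_dominatesP => A mA muA0; rewrite density_measureE.
by apply: null_set_integral => //; exact: measurable_funTS.
Qed.

(** The Radon-Nikodym derivative satisfies the change of variables formula, and it equals [h] almost
    everywhere because both have the same integral over every measurable set. *)
Lemma ge0_integral_density f : (forall x, 0 <= f x)%E -> measurable_fun setT f ->
  (\int[density_measure]_x f x = \int[mu]_x (f x * (h x)%:E))%E.
Proof.
move=> f0 mf; have dom := density_dominates.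
have irn := Radon_Nikodym_SigmaFinite.f_integrable dom.
have mrn : measurable_fun setT (Radon_Nikodym_SigmaFinite.f density_measure mu).
  by case/integrableP: irn.
rewrite -(Radon_Nikodym_SigmaFinite.change_of_variables dom) //.
apply: ae_eq_integral => //; first exact: emeasurable_funM.
  exact: emeasurable_funM.
apply: ae_eqe_mul2l; apply: integral_ae_eq => //.
by move=> E _ mE; rewrite -Radon_Nikodym_SigmaFinite.f_integral.
Qed.

Lemma integrable_density g : measurable_fun setT (EFin \o g) ->
  mu.-integrable setT (EFin \o (fun x => g x * h x)) ->
  density_measure.-integrable setT (EFin \o g).
Proof.
move=> mg /integrableP[_ igh]; apply/integrableP; split=> //.
rewrite ge0_integral_density //; last exact: measurableT_comp.
apply: le_lt_trans igh; apply: ge0_le_integral => //.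
- by move=> x _; rewrite mule_ge0 // lee_fin.
- by apply: emeasurable_funM => //; exact: measurableT_comp.
- apply: measurableT_comp => //; apply/measurable_EFinP.
  by apply: measurable_funM; apply/measurable_EFinP.
- by move=> x _ /=; rewrite normrM EFinM (ger0_norm (h0 x)).
Qed.

Lemma Rintegral_density g : measurable_fun setT (EFin \o g) ->
  \int[density_measure]_x g x = \int[mu]_x (g x * h x).
Proof.
move=> mg; rewrite /Rintegral integralE [in RHS]integralE.
rewrite !ge0_integral_density //; [|exact: measurable_funeneg|exact: measurable_funepos].
congr (fine (_ - _)); apply: eq_integral => x _; rewrite ?funeposE ?funenegE /=.
  by rewrite -!EFin_max -EFinM maxr_pMl // mul0r.
by rewrite -!EFin_max -EFinM maxr_pMl // mul0r mulNr.
Qed.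

End DensityMeasure.

Section ChargeDensity.
Variable R : realType.
Local Notation TR := (measurableTypeR R).
Local Notation leb := (@lebesgue_measure R).

(** The positive and negative parts of [h] give finite measures with difference [nu], so no Hahn
    decomposition has to be identified. *)
Lemma charge_integral_density (nu : {charge set TR -> \bar R}) (h g : R -> R) :
  (forall X, measurable X -> nu X = with_density h X) ->
  leb.-integrable setT (EFin \o h) ->
  measurable_fun setT g ->
  leb.-integrable setT (EFin \o (fun x => g x * h x)) ->
  charge_integral nu g = \int[leb]_t (g t * h t).
Proof.
move=> nuE ih mg igh.
pose hp x := Num.max (h x) 0; pose hn x := Num.max (- h x) 0.
have hp0 x : 0 <= hp x by rewrite le_max lexx orbT.
have hn0 x : 0 <= hn x by rewrite le_max lexx orbT.
have hE x : h x = hp x - hn x.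
  by rewrite /hp /hn; case: (leP (h x) 0) => h0; case: leP => h1; lra.
have hpE : EFin \o hp = ((EFin \o h)^\+)%E.
  by apply/funext => x; rewrite funeposE /= EFin_max.
have hnE : EFin \o hn = ((EFin \o h)^\-)%E.
  by apply/funext => x; rewrite funenegE /= EFin_max EFinN.
have ihp : leb.-integrable setT (EFin \o hp) by rewrite hpE; exact: integrable_funepos.
have ihn : leb.-integrable setT (EFin \o hn) by rewrite hnE; exact: integrable_funeneg.
have mh : measurable_fun setT h by apply/measurable_EFinP; case/integrableP: ih.
have bound (k : R -> R) : measurable_fun setT k -> (forall x, `|k x| <= `|h x|) ->
    leb.-integrable setT (EFin \o (fun x => g x * k x)).
  move=> mk kh; apply: le_integrable igh => //.
    by apply/measurable_EFinP; exact: measurable_funM.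
  by move=> x _ /=; rewrite lee_fin !normrM ler_wpM2l.
have mhp : measurable_fun setT hp by apply/measurable_EFinP; case/integrableP: ihp.
have mhn : measurable_fun setT hn by apply/measurable_EFinP; case/integrableP: ihn.
have igp : leb.-integrable setT (EFin \o (fun x => g x * hp x)).
  apply: bound => // x; rewrite (ger0_norm (hp0 x)) /hp.
  by case: (leP (h x) 0) => // _; exact: ler_norm.
have ign : leb.-integrable setT (EFin \o (fun x => g x * hn x)).
  apply: bound => // x; rewrite (ger0_norm (hn0 x)) /hn.
  by case: (leP (- h x) 0) => // _; rewrite -normrN ler_norm.
have mg' : measurable_fun setT (EFin \o g) by apply/measurable_EFinP.
rewrite (@charge_integral_diff _ nu (density_measure ihp hp0) (density_measure ihn hn0)).
- rewrite !Rintegral_density // -RintegralB //.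
  by apply: eq_Rintegral => x _; rewrite [in RHS]hE mulrBr.
- move=> X mX; rewrite nuE //.
  change (with_density h X =
    (\int[leb]_(x in X) (hp x)%:E - \int[leb]_(x in X) (hn x)%:E)%E).
  rewrite -integralB_EFin //; [|exact: (integrableS measurableT)..].
  by apply: eq_integral => x _; rewrite hE.
- exact: integrable_density.
- exact: integrable_density.
Qed.

End ChargeDensity.

(** * Arcsine moments *)

(* The fundamental theorem on an open interval, where f may be unbounded at the
   ends: exhaust the interval by the closed intervals [u n, v n]. *)
Section OpenFTC.
Variable R : realType.
Local Notation leb := (@lebesgue_measure R).
Variables (a b la lb : R) (f F : R -> R) (u v : nat -> R).
Hypothesis dF : forall x, a < x < b -> is_derive x 1 F (f x).
Hypothesis cf : forall x, a < x < b -> {for x, continuous f}.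
Hypothesis u_decr : nonincreasing_seq u.
Hypothesis v_incr : nondecreasing_seq v.
Hypothesis uv : forall n, [/\ a < u n, u n < v n & v n < b].
Hypothesis cvg_u : u n @[n --> \oo] --> a.
Hypothesis cvg_v : v n @[n --> \oo] --> b.
Hypothesis cvg_Fu : F (u n) @[n --> \oo] --> la.
Hypothesis cvg_Fv : F (v n) @[n --> \oo] --> lb.

Lemma FTC_exhausting n :
  (\int[leb]_(x in `[u n, v n]) (f x)%:E = (F (v n))%:E - (F (u n))%:E)%E.
Proof.
have [au uv_n vb] := uv n.
have inab x : u n <= x <= v n -> a < x < b.
  by move=> /andP[h1 h2]; rewrite (lt_le_trans au h1) (le_lt_trans h2 vb).
have cF x : u n <= x <= v n -> {for x, continuous F}.
  move=> /inab /dF h; apply: differentiable_continuous.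
  by apply/derivable1_diffP; exact: ex_derive.
apply: continuous_FTC2 => //.
- apply: continuous_in_subspaceT => x; rewrite inE /= in_itv /= => h.
  exact: cf (inab _ h).
- split.
  + move=> x; rewrite in_itv /= => /andP[/ltW h1 /ltW h2].
    by have h := dF (inab x _); apply: ex_derive; apply: h; rewrite h1 h2.
  + by apply: cvg_at_right_filter; apply: cF; rewrite lexx ltW.
  + by apply: cvg_at_left_filter; apply: cF; rewrite lexx ltW.
- move=> x; rewrite in_itv /= => /andP[/ltW h1 /ltW h2].
  by rewrite derive1E; apply: derive_val; apply: dF; apply: inab; rewrite h1 h2.
Qed.

Lemma exhaust_itv : \bigcup_n `[u n, v n]%classic = `]a, b[%classic.
Proof.
apply/seteqP; split=> [x [n _] /= | x /=]; rewrite !in_itv /=.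
  by have [h1 _ h2] := uv n; move=> /andP[/(lt_le_trans h1) -> /le_lt_trans ->].
move=> /andP[ax xb].
have [n [un vn]] : exists n, u n < x /\ x < v n.
  have hu : \forall n \near \oo, u n < x by exact: cvgr_lt cvg_u _ ax.
  have hv : \forall n \near \oo, x < v n by exact: cvgr_gt cvg_v _ xb.
  have [n _ hn] := filterI hu hv.
  by exists n; apply: hn => /=.
by exists n => //=; rewrite in_itv /= !ltW.
Qed.

Lemma nd_exhaust : nondecreasing_seq (fun n => `[u n, v n]%classic).
Proof.
move=> m n mn; apply/subsetPset => x /=; rewrite !in_itv /= => /andP[h1 h2].
by rewrite (le_trans (u_decr mn) h1) (le_trans h2 (v_incr mn)).
Qed.

Lemma measurable_open_itv : measurable_fun `]a, b[ f.
Proof.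
apply: open_continuous_measurable_fun; first exact: interval_open.
by move=> x; rewrite inE /= in_itv /=; exact: cf.
Qed.

Lemma cvg_increment :
  ((F (v n))%:E - (F (u n))%:E)%E @[n --> \oo] --> (lb - la)%:E.
Proof.
by apply: cvg_EFin; [exact: nearW | exact: cvgB].
Qed.

Lemma cvg_exhaust (g : R -> \bar R) : measurable_fun `]a, b[ g ->
  (forall x, 0 <= g x)%E ->
  (\int[leb]_(x in `[u n, v n]) g x)%E @[n --> \oo]
    --> (\int[leb]_(x in `]a, b[) g x)%E.
Proof.
move=> mg g0; have sub n : `[u n, v n]%classic `<=` `]a, b[%classic.
  by rewrite -exhaust_itv => x ux; exists n.
have := @ge0_nondecreasing_set_cvg_integral _ (measurableTypeR R) R
  (fun n => `[u n, v n]%classic) g leb nd_exhaust.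
rewrite exhaust_itv; apply=> // n.
exact: measurable_funS mg.
Qed.

(** Monotone convergence needs a sign, so it is applied to the positive and negative parts of [f];
    integrability keeps the difference of the two limits meaningful. *)
Lemma integral_FTC_open : leb.-integrable `]a, b[ (EFin \o f) ->
  (\int[leb]_(x in `]a, b[) (f x)%:E = (lb - la)%:E)%E.
Proof.
move=> fi; have mf : measurable_fun `]a, b[ (EFin \o f) by case/integrableP: fi.
have sub n : `[u n, v n]%classic `<=` `]a, b[%classic.
  by rewrite -exhaust_itv => x ux; exists n.
have e n : ((F (v n))%:E - (F (u n))%:E)%E
    = (\int[leb]_(x in `[u n, v n]) ((EFin \o f)^\+ x)
      - \int[leb]_(x in `[u n, v n]) ((EFin \o f)^\- x))%E.
  by rewrite -FTC_exhausting integralE.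
have := cvg_increment; under eq_fun do rewrite e.
move/(cvg_lim (@ereal_hausdorff R)) => <-; apply/esym/cvg_lim => //.
rewrite integralE; apply: cvgeB.
- rewrite fin_num_adde_defr // integrable_fin_num //=.
  exact: integrable_funepos.
- by apply: cvg_exhaust => //; exact: measurable_funepos.
- by apply: cvg_exhaust => //; exact: measurable_funeneg.
Qed.

(** For nonnegative [f] the convergent increments of [F] give the integral, with no estimate of [f]
    near the ends. *)
Lemma integrable_FTC_open_ge0 : (forall x, a < x < b -> 0 <= f x) ->
  leb.-integrable `]a, b[ (EFin \o f).
Proof.
move=> f0; have mf : measurable_fun `]a, b[ (EFin \o f).
  by apply/measurable_EFinP; exact: measurable_open_itv.
apply/integrableP; split=> //.
suff -> : (\int[leb]_(x in `]a, b[) `|(EFin \o f) x| = (lb - la)%:E)%E by rewrite ltry.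
have := cvg_increment.
move/(cvg_lim (@ereal_hausdorff R)) => <-; apply/esym/cvg_lim => //.
have e n : ((F (v n))%:E - (F (u n))%:E)%E
    = (\int[leb]_(x in `[u n, v n]) `|(EFin \o f) x|)%E.
  rewrite -FTC_exhausting; apply: eq_integral => x; rewrite inE /= in_itv /=.
  move=> /andP[h1 h2]; have [au _ vb] := uv n; rewrite ger0_norm // f0 //.
  by rewrite (lt_le_trans au h1) (le_lt_trans h2 vb).
under eq_fun do rewrite e.
by apply: cvg_exhaust => //; exact: measurableT_comp.
Qed.

End OpenFTC.

Section ArcsineMoments.
Variable R : realType.
Local Notation leb := (@lebesgue_measure R).

Lemma cvg_inv_shift : ((n + 3)%:R^-1 : R) @[n --> \oo] --> (0 : R).
Proof. by rewrite (cvg_shiftn 3 (fun n => n%:R^-1 : R)); exact: cvg_invn. Qed.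

(** The shift by 3 keeps the value below 1/2 from n = 0 on, so that a + e n < b - e n for every
    [n]. *)
Lemma inv_shift_bounds n : 0 < ((n + 3)%:R^-1 : R) < 2^-1.
Proof.
have n0 : 0 < ((n + 3)%:R : R) by rewrite ltr0n addn_gt0 orbT.
by rewrite invr_gt0 n0 ltf_pV2 ?posrE // ltr_nat addnC.
Qed.

Lemma inv_shift_decr m n : (m <= n)%N -> ((n + 3)%:R^-1 : R) <= (m + 3)%:R^-1.
Proof. by move=> mn; rewrite lef_pV2 ?posrE ?ltr0n ?addn_gt0 ?orbT // ler_nat leq_add2r. Qed.

Lemma integral_FTC_continuous (a b : R) (f F : R -> R) : a < b -> continuous F ->
  (forall x, a < x < b -> is_derive x 1 F (f x)) ->
  (forall x, a < x < b -> {for x, continuous f}) ->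
  leb.-integrable `]a, b[ (EFin \o f) ->
  (\int[leb]_(x in `]a, b[) (f x)%:E = (F b - F a)%:E)%E.
Proof.
move=> ab cF dF cf fi; pose e n : R := (b - a) * (n + 3)%:R^-1.
have ba : 0 < b - a by rewrite subr_gt0.
have ce : e n @[n --> \oo] --> (0 : R).
  by rewrite -(mulr0 (b - a)); apply: cvgMl_tmp; exact: cvg_inv_shift.
have cu : a + e n @[n --> \oo] --> a.
  by rewrite -[X in _ --> X]addr0; apply: cvgD ce; exact: cvg_cst.
have cv : b - e n @[n --> \oo] --> b.
  by rewrite -[X in _ --> X]subr0; apply: cvgB ce; exact: cvg_cst.
have e_decr m n : (m <= n)%N -> e n <= e m.
  by move=> mn; rewrite /e ler_pM2l // inv_shift_decr.
apply: (@integral_FTC_open _ a b (F a) (F b) f F (fun n => a + e n) (fun n => b - e n)) => //.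
- by move=> m n mn; rewrite lerD2l e_decr.
- by move=> m n mn; rewrite lerB // e_decr.
- move=> n; have /andP[h0 h1] := inv_shift_bounds n.
  have e0 : 0 < e n by rewrite /e mulr_gt0.
  have e1 : e n < (b - a) / 2 by rewrite /e ltr_pM2l.
  by split; lra.
- exact: (cvg_comp _ F cu (cF a)).
- exact: (cvg_comp _ F cv (cF b)).
Qed.

Variable r : R.
Hypothesis r0 : 0 < r.

Definition arcsine_kernel (t : R) : R := (Num.sqrt (r ^+ 2 - t ^+ 2))^-1.

Lemma arcsine_radicand (t : R) : - r < t < r -> 0 < r ^+ 2 - t ^+ 2.
Proof. by move=> /andP[h1 h2]; rewrite subr_sqr mulr_gt0 //; lra. Qed.

Lemma is_derive_radicand (t : R) :
  is_derive t 1 (fun s => r ^+ 2 - s ^+ 2 : R) (- (2 * t)).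
Proof.
apply: is_derive_eq.
by rewrite /GRing.scale /=; ring.
Qed.

Lemma is_derive_semicircle (t : R) : - r < t < r ->
  is_derive t 1 (fun s => Num.sqrt (r ^+ 2 - s ^+ 2) : R) (- (t * arcsine_kernel t)).
Proof.
move=> /arcsine_radicand h; have hd := is_derive_radicand t.
have hs := is_derive1_sqrt h.
apply: (is_derive_eq (is_derive1_comp (g := fun s : R => r ^+ 2 - s ^+ 2) hs hd)).
have s0 : Num.sqrt (r ^+ 2 - t ^+ 2) != 0 by rewrite gt_eqF // sqrtr_gt0.
by rewrite /arcsine_kernel /GRing.scale /=; field.
Qed.

Lemma continuous_semicircle : continuous (fun s : R => Num.sqrt (r ^+ 2 - s ^+ 2)).
Proof.
move=> s; apply: (@continuous_comp _ _ _ (fun s : R => r ^+ 2 - s ^+ 2) Num.sqrt).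
  by apply: cvgB; [exact: cvg_cst | exact: exprn_continuous].
exact: sqrt_continuous.
Qed.

Lemma continuous_arcsine_kernel (t : R) : - r < t < r ->
  {for t, continuous arcsine_kernel}.
Proof.
move=> /arcsine_radicand h; apply: cvgV; first by rewrite gt_eqF // sqrtr_gt0.
exact: continuous_semicircle.
Qed.

Lemma is_derive_asin_scale (t : R) : - r < t < r ->
  is_derive t 1 (fun s => asin (s / r)) (arcsine_kernel t).
Proof.
move=> h; have ht : -1 < t / r < 1.
  by move: h => /andP[h1 h2]; rewrite ltr_pdivlMr // ltr_pdivrMr // mulN1r mul1r h1.
have hd : is_derive t 1 (fun s : R => s / r) r^-1.
  by apply: is_derive_eq; rewrite /GRing.scale /= mulr1 ?mul1r; ring.
apply: (is_derive_eq (is_derive1_comp (g := fun s : R => s / r) (is_derive1_asin ht) hd)).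
have e : r ^+ 2 - t ^+ 2 = r ^+ 2 * (1 - (t / r) ^+ 2) by field; rewrite gt_eqF.
rewrite /arcsine_kernel e sqrtrM ?sqr_ge0 // sqrtr_sqr gtr0_norm // invfM.
by rewrite /GRing.scale /=; ring.
Qed.

Lemma measurable_arcsine_kernel : measurable_fun `]- r, r[ arcsine_kernel.
Proof.
apply: open_continuous_measurable_fun; first exact: interval_open.
by move=> x; rewrite inE /= in_itv /=; exact: continuous_arcsine_kernel.
Qed.

Lemma arcsine_kernel_ge0 t : 0 <= arcsine_kernel t.
Proof. by rewrite invr_ge0 sqrtr_ge0. Qed.

(* The exhaustion is by the points r sin(theta), at which asin is explicit. *)
Lemma arcsine_integral : leb.-integrable `]- r, r[ (EFin \o arcsine_kernel)
  /\ (\int[leb]_(x in `](- r)%R, r[) (arcsine_kernel x)%:E = pi%:E)%E.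
Proof.
have pi0 := pi_gt0 R.
pose th n : R := pi / 2 * (1 - (n + 3)%:R^-1); pose v n := r * sin (th n).
have th_bounds n : 0 < th n < pi / 2.
  have /andP[h0 h1] := inv_shift_bounds n; rewrite /th mulr_gt0 ?divr_gt0 //=; last by lra.
  by rewrite gtr_pMr ?divr_gt0 //; lra.
have sin_bounds n : 0 < sin (th n) < 1.
  have /andP[h0 h1] := th_bounds n; rewrite sin_gt0_pi /=; last by rewrite h0; lra.
  by rewrite -(sin_pihalf R) ltr_sin // in_itv /=; lra.
have th_incr m n : (m <= n)%N -> th m <= th n.
  by move=> mn; rewrite /th ler_pM2l ?divr_gt0 // lerB // inv_shift_decr.
have v_incr m n : (m <= n)%N -> v m <= v n.
  move=> mn; have hm := th_bounds m; have hn := th_bounds n.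
  by rewrite /v ler_pM2l // leNgt ltr_sin -?leNgt ?th_incr // in_itv /=; lra.
have cth : th n @[n --> \oo] --> pi / 2.
  rewrite -[X in _ --> X]mulr1; apply: cvgMl_tmp; rewrite -[X in _ --> X]subr0.
  by apply: cvgB; [exact: cvg_cst | exact: cvg_inv_shift].
have cv : v n @[n --> \oo] --> r.
  rewrite -[X in _ --> X]mulr1; apply: cvgMl_tmp; rewrite -(sin_pihalf R).
  by apply: (cvg_comp _ (@sin R) cth); exact: continuous_sin.
have Fv n : asin (v n / r) = th n.
  rewrite /v mulrAC divff ?gt_eqF // mul1r sinK // in_itv /=.
  by have := th_bounds n; lra.
have asinN n : asin (- v n / r) = - th n.
  rewrite mulNr /v mulrAC divff ?gt_eqF // mul1r -sinN sinK // in_itv /=.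
  by have := th_bounds n; lra.
have v_in n : [/\ - r < - v n, - v n < v n & v n < r].
  have /andP[h0 h1] := sin_bounds n.
  have v0 : 0 < v n by rewrite /v mulr_gt0.
  have v1 : v n < r by rewrite /v gtr_pMr.
  by split; lra.
have cFv : asin (v n / r) @[n --> \oo] --> pi / 2 by under eq_fun do rewrite Fv.
have cFu : asin (- v n / r) @[n --> \oo] --> - (pi / 2).
  by under eq_fun do rewrite asinN; exact: cvgN.
have cu : - v n @[n --> \oo] --> - r by exact: cvgN.
have u_decr m n : (m <= n)%N -> - v n <= - v m by move=> mn; rewrite lerN2 v_incr.
have hi := integrable_FTC_open_ge0 is_derive_asin_scale continuous_arcsine_kernel
  u_decr v_incr v_in cu cv cFu cFv (fun x _ => arcsine_kernel_ge0 x).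
split=> //.
rewrite (integral_FTC_open is_derive_asin_scale continuous_arcsine_kernel
  u_decr v_incr v_in cu cv cFu cFv hi).
by congr EFin; lra.
Qed.

Definition arcsine_moment k := \int[leb]_(t in `]- r, r[) (t ^+ k * arcsine_kernel t).

Lemma integrable_arcsine_moment k :
  leb.-integrable `]- r, r[ (EFin \o (fun t => t ^+ k * arcsine_kernel t)).
Proof.
have [hi _] := arcsine_integral.
apply: (le_integrable _ _ _ (integrableZl _ (r ^+ k) hi)) => //.
  apply/measurable_EFinP; apply: measurable_funM; last exact: measurable_arcsine_kernel.
  by apply: measurable_funTS; exact: exprn_measurable.
move=> x /=; rewrite in_itv /= => /andP[h1 h2].
rewrite lee_fin !normrM ler_wpM2r // !normrX lerXn2r ?nnegrE ?normr_ge0 //.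
by rewrite (gtr0_norm r0) ler_norml !ltW.
Qed.

Lemma arcsine_moment0 : arcsine_moment 0 = pi.
Proof.
have [_ e] := arcsine_integral.
by rewrite /arcsine_moment /Rintegral; under eq_integral do rewrite expr0 mul1r; rewrite e.
Qed.

Lemma arcsine_moment1 : arcsine_moment 1 = 0.
Proof.
have rr : - r < r by rewrite gtrN.
have hi := integrable_arcsine_moment 1.
pose F (s : R) : R := - Num.sqrt (r ^+ 2 - s ^+ 2).
have cF : continuous F by move=> x; apply: cvgN; exact: continuous_semicircle.
have dF (x : R) : - r < x < r -> is_derive x 1 F (x ^+ 1 * arcsine_kernel x).
  by move=> /is_derive_semicircle hx; apply: (is_derive_eq (is_deriveN hx)); rewrite opprK.
have cf (x : R) : - r < x < r -> {for x, continuous (fun t : R => t ^+ 1 * arcsine_kernel t)}.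
  move=> hx; apply: cvgM; last exact: continuous_arcsine_kernel.
  exact: exprn_continuous.
rewrite /arcsine_moment /Rintegral (integral_FTC_continuous rr cF dF cf hi).
by rewrite /F sqrrN subrr.
Qed.

(** t^(k+1) sqrt (r^2 - t^2) vanishes at both ends. As sqrt (r^2 - t^2) is r^2 - t^2 times the
    kernel, its derivative is (k + 1) r^2 t^k - (k + 2) t^(k+2), times the kernel. *)
Lemma arcsine_moment_rec k :
  k.+2%:R * arcsine_moment k.+2 = k.+1%:R * r ^+ 2 * arcsine_moment k.
Proof.
have rr : - r < r by rewrite gtrN.
pose f (t : R) : R := k.+1%:R * r ^+ 2 * (t ^+ k * arcsine_kernel t)
  - k.+2%:R * (t ^+ k.+2 * arcsine_kernel t).
have mI : measurable (`]- r, r[%classic : set (measurableTypeR R)) by exact: measurable_itv.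
have hk := integrable_arcsine_moment k; have hk2 := integrable_arcsine_moment k.+2.
have h1 : leb.-integrable `]- r, r[
    (EFin \o (fun t => k.+1%:R * r ^+ 2 * (t ^+ k * arcsine_kernel t))).
  exact: (integrableZl mI (k.+1%:R * r ^+ 2) hk).
have h2 : leb.-integrable `]- r, r[
    (EFin \o (fun t => k.+2%:R * (t ^+ k.+2 * arcsine_kernel t))).
  exact: (integrableZl mI k.+2%:R hk2).
have hi : leb.-integrable `]- r, r[ (EFin \o f) by exact: (integrableB mI h1 h2).
pose F (s : R) : R := s ^+ k.+1 * Num.sqrt (r ^+ 2 - s ^+ 2).
have cF : continuous F.
  by move=> x; apply: cvgM; [exact: exprn_continuous | exact: continuous_semicircle].
have dF (x : R) : - r < x < r -> is_derive x 1 F (f x).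
  move=> hx; have hd := is_derive_semicircle hx.
  have hp : is_derive x 1 (fun s : R => s ^+ k.+1) (k.+1%:R * x ^+ k).
    apply: DeriveDef; first exact: exprn_derivable.
    by rewrite exp_derive /GRing.scale /= mulr1.
  apply: (is_derive_eq (is_deriveM hp hd)).
  have h := arcsine_radicand hx.
  have es : Num.sqrt (r ^+ 2 - x ^+ 2) = (r ^+ 2 - x ^+ 2) * arcsine_kernel x.
    rewrite /arcsine_kernel -{2}[r ^+ 2 - x ^+ 2]sqr_sqrtr ?ltW // expr2 mulfK //.
    by rewrite gt_eqF // sqrtr_gt0.
  by rewrite /GRing.scale /= es /f !exprS -!natr1; ring.
have cf (x : R) : - r < x < r -> {for x, continuous f}.
  move=> hx; have ck := continuous_arcsine_kernel hx.
  by apply: cvgB; apply: cvgM; try exact: cvg_cst; apply: cvgM => //;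
    exact: exprn_continuous.
have : \int[leb]_(t in `]- r, r[) f t = 0.
  rewrite /Rintegral (integral_FTC_continuous rr cF dF cf hi) /F sqrrN subrr.
  by rewrite sqrtr0 !mulr0 subrr.
rewrite /f RintegralB // !RintegralZl // => /eqP; rewrite subr_eq0 => /eqP ->.
by [].
Qed.

Lemma arcsine_moment_odd k : odd k -> arcsine_moment k = 0.
Proof.
elim/ltn_ind: k => -[|[|k]] IH //=; first by rewrite arcsine_moment1.
rewrite negbK => ok; have := arcsine_moment_rec k.
rewrite (IH k) // mulr0 => /eqP; rewrite mulf_eq0 pnatr_eq0 /= => /eqP //.
Qed.

Lemma arcsine_moment_even p :
  arcsine_moment p.*2 = pi * 'C(p.*2, p)%:R * (r ^+ 2 / 4) ^+ p.
Proof.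
elim: p => [|p IH]; first by rewrite arcsine_moment0 expr0 !mulr1.
have := arcsine_moment_rec p.*2; rewrite -doubleS IH => e.
have e2 : p.*2.+2%:R = 2 * p.+1%:R :> R by rewrite -doubleS -mul2n natrM.
have e1 : p.*2.+1.*2%:R = 2 * p.*2.+1%:R :> R by rewrite -mul2n natrM.
have := congr1 (fun n : nat => n%:R : R) (central_binS p); rewrite !natrM e1 => hc.
have p0 : p.+1%:R != 0 :> R by rewrite pnatr_eq0.
apply: (@mulfI _ (2 * p.+1%:R)); first by rewrite mulf_neq0 // pnatr_eq0.
rewrite -e2 e [(_ / 4) ^+ p.+1]exprS; move: ((_ / 4) ^+ p) => Q.
transitivity (pi * (r ^+ 2 / 4 * Q) * 2
    * (p.+1%:R * 'C(p.+1.*2, p.+1)%:R)); last by rewrite e2; ring.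
by rewrite hc; field.
Qed.

End ArcsineMoments.

(** * The limit charges *)

Section ArcsineDensities.
Variable R : realType.
Local Notation leb := (@lebesgue_measure R).
Local Notation TR := (measurableTypeR R).
Variables (r : R) (r0 : 0 < r).

(** Common form of the limit densities: [j] is 2 and 0 in the free case and 1 in the monotone
    case. *)
Definition arcsine_density c j (t : R) : R :=
  c * (t ^+ j * arcsine_kernel r t) * \1_(`]- r, r[%classic) t.

Lemma arcsine_densityE c j k :
  (fun t => t ^+ k * arcsine_density c j t)
  = (fun t => c * (t ^+ (k + j) * arcsine_kernel r t)) \_ `]- r, r[.
Proof.
apply/funext => t; rewrite patchE /arcsine_density indicE.
case: (t \in _); last by rewrite !mulr0.
by rewrite mulr1 exprD; ring.
Qed.

Let mI : measurable (`]- r, r[%classic : set TR).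
Proof. exact: measurable_itv. Qed.

Lemma integrable_arcsine_density c j k :
  leb.-integrable setT (EFin \o (fun t => t ^+ k * arcsine_density c j t)).
Proof.
rewrite arcsine_densityE -restrict_EFin; apply: (integrable_mkcond _ mI).1.
exact: (integrableZl mI c (integrable_arcsine_moment r0 (k + j))).
Qed.

Lemma Rintegral_arcsine_density c j k :
  \int[leb]_t (t ^+ k * arcsine_density c j t) = c * arcsine_moment r (k + j).
Proof.
have -> : \int[leb]_t (t ^+ k * arcsine_density c j t)
    = \int[leb]_t ((fun t => c * (t ^+ (k + j) * arcsine_kernel r t)) \_ `]- r, r[) t.
  by rewrite -arcsine_densityE.
rewrite -Rintegral_mkcond RintegralZl //; exact: integrable_arcsine_moment.
Qed.

Lemma integrable_arcsine_density0 c j :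
  leb.-integrable setT (EFin \o arcsine_density c j).
Proof.
have := integrable_arcsine_density c j 0.
by rewrite (_ : (fun t => _) = arcsine_density c j) //; apply/funext => t; rewrite expr0 mul1r.
Qed.

Definition semicircle (t : R) : R := Num.sqrt (r ^+ 2 - t ^+ 2).

Lemma semicircle_out t : ~ (- r < t < r) -> semicircle t = 0.
Proof.
move=> h; apply/eqP; rewrite sqrtr_eq0 subr_le0.
rewrite -[leLHS]ger0_norm ?sqr_ge0 // -[leRHS]ger0_norm ?sqr_ge0 //.
rewrite !normrX lerXn2r ?nnegrE // (gtr0_norm r0).
by rewrite leNgt ltr_norml; apply/negP.
Qed.

Lemma integral_semicircle (s t : R) : s < t ->
  (\int[leb]_(x in `]s, t]) (arcsine_density (- 1) 1 x)%:E
  = (semicircle t - semicircle s)%:E)%E.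
Proof.
move=> st; rewrite integral_itv_bndoo; last first.
  apply: measurable_funTS.
  by have /integrableP[] := integrable_arcsine_density0 (- 1) 1.
(* Clipping to ]-r, r[ changes neither side, since the density and [semicircle] vanish outside. If b
   < a, both ends lie outside. *)
pose a := Num.max s (- r); pose b := Num.min t r.
pose f x := - (x * arcsine_kernel r x).
have -> : (\int[leb]_(x in `]s, t[) (arcsine_density (- 1) 1 x)%:E
    = \int[leb]_(x in `]a, b[) (f x)%:E)%E.
  rewrite integral_mkcond [RHS]integral_mkcond; apply: eq_integral => x _.
  rewrite !patchE /arcsine_density indicE expr1 /f mulN1r.
  rewrite !mem_setE !in_itv /= gt_max lt_min.
  by case: (s < x); case: (x < t); case: (- r < x); case: (x < r) => //=; rewrite ?mulr1 ?mulr0.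
have inr x : a < x < b -> - r < x < r.
  by rewrite gt_max lt_min => /andP[/andP[_ ->] /andP[_ ->]].
have sa : semicircle s = semicircle a.
  rewrite /a; case: leP => // h; rewrite !semicircle_out //.
    by rewrite ltxx.
  by rewrite ltNge h.
have sb : semicircle t = semicircle b.
  rewrite /b; case: leP => // h; rewrite !semicircle_out //.
    by rewrite ltxx andbF.
  by rewrite [t < r]ltNge (ltW h) andbF.
rewrite sa sb; have [ab|ba] := ltP a b; last first.
  rewrite set_itv_ge ?integral_set0 -?leNgt ?bnd_simp //.
  have [->|ne] := eqVneq a b; first by rewrite subrr.
  have ba' : b < a by rewrite lt_neqAle eq_sym ne.
  rewrite !semicircle_out ?subrr //; move: ba'; rewrite /a /b;
    case: (leP s (- r)); case: (leP t r) => h1 h2 h3; apply/negP; lra.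
apply: integral_FTC_continuous => //.
- exact: continuous_semicircle.
- by move=> x /inr hx; exact: is_derive_semicircle.
- move=> x /inr hx; apply: cvgN; apply: cvgM; first exact: cvg_id.
  exact: continuous_arcsine_kernel.
- have mab : measurable (`]a, b[%classic : set TR) by exact: measurable_itv.
  have hd := integrableS measurableT mab (@subsetT _ _)
    (integrable_arcsine_density0 (- 1) 1).
  apply: eq_integrable hd => //.
  move=> x; rewrite inE /= in_itv /= => /inr hx.
  by rewrite /= /arcsine_density indicE mem_set ?mulr1 ?expr1 ?mulN1r // /= in_itv.
Qed.

(** The function increases on [-r, 0] and decreases on [0, r]. *)
Lemma bounded_variation_semicircle c : 0 <= c ->
  bounded_variation (- r) r (fun t => c * semicircle t).
Proof.
move=> c0; set f := fun t => _; have nr : - r <= 0 by rewrite oppr_le0 ltW.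
have b1 : bounded_variation (- r) 0 f.
  apply: nondecreasing_bounded_variation => x y.
  rewrite !in_itv /= => /andP[_ x0] /andP[_ y0] xy; apply: ler_wpM2l => //.
  by apply: ler_wsqrtr; rewrite lerB // -(sqrrN x) -(sqrrN y) lerXn2r ?nnegrE ?oppr_ge0 ?lerN2.
have b2 : bounded_variation 0 r f.
  have -> : f = \- (\- f) by apply/funext => x /=; rewrite opprK.
  apply: bounded_variationN; apply: nondecreasing_bounded_variation => x y.
  rewrite !in_itv /= => /andP[x0 _] /andP[y0 _] xy; rewrite lerN2; apply: ler_wpM2l => //.
  by apply: ler_wsqrtr; rewrite lerB // lerXn2r ?nnegrE.
apply/bounded_variationP; first by rewrite (le_trans nr) ?ltW.
rewrite (total_variationD _ nr (ltW r0)) fin_numD.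
by apply/andP; split; apply/bounded_variationP => //; exact: ltW.
Qed.

End ArcsineDensities.

Section LimitCharges.
Variable R : realType.
Local Notation leb := (@lebesgue_measure R).
Local Notation TR := (measurableTypeR R).

Let two_gt0 : 0 < (2 : R). Proof. by []. Qed.
Let sqrt2_gt0 : 0 < Num.sqrt (2 : R). Proof. by rewrite sqrtr_gt0. Qed.

Lemma measurable_exprn k : measurable_fun [set: R] (fun t : R => t ^+ k).
Proof. exact: exprn_measurable. Qed.

Lemma free_density1E : @free_density1 R = arcsine_density 2 (2 * pi)^-1 2.
Proof.
apply/funext => t; rewrite /free_density1 /arcsine_density /arcsine_kernel.
by rewrite -natrX.
Qed.

Lemma free_density2E : @free_density2 R = arcsine_density 2 pi^-1 0.
Proof.
apply/funext => t; rewrite /free_density2 /arcsine_density /arcsine_kernel.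
by rewrite -natrX expr0 mul1r invfM.
Qed.

Lemma monotone_densityE :
  @monotone_density R = arcsine_density (Num.sqrt 2) (- (2 * pi)^-1) 1.
Proof.
apply/funext => t; rewrite /monotone_density /arcsine_density /arcsine_kernel.
by rewrite sqr_sqrtr // expr1 !invfM; ring.
Qed.

Lemma integrable_free_density :
  leb.-integrable setT (EFin \o (fun t => free_density1 t - free_density2 t)).
Proof.
rewrite free_density1E free_density2E.
exact: (integrableB measurableT (integrable_arcsine_density0 two_gt0 (2 * pi)^-1 2)
  (integrable_arcsine_density0 two_gt0 pi^-1 0)).
Qed.

Definition free_charge : {charge set TR -> \bar R} :=
  induced_charge integrable_free_density.

Lemma free_chargeE X : measurable X ->
  free_charge X = (with_density (@free_density1 R) X - with_density (@free_density2 R) X)%E.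
Proof.
move=> mX; rewrite /free_charge /= /induced_charge /with_density.
under eq_integral do rewrite /= EFinB.
rewrite integralB_EFin // ?free_density1E ?free_density2E;
  by apply: (integrableS measurableT) => //; exact: integrable_arcsine_density0.
Qed.

Lemma free_charge_integral k : charge_integral free_charge (fun t => t ^+ k)
  = (2 * pi)^-1 * arcsine_moment 2 k.+2 - pi^-1 * arcsine_moment 2 k.
Proof.
have i1 := integrable_arcsine_density two_gt0 (2 * pi)^-1 2 k.
have i2 := integrable_arcsine_density two_gt0 pi^-1 0 k.
have e (t : R) : t ^+ k * (free_density1 t - free_density2 t)
    = t ^+ k * arcsine_density 2 (2 * pi)^-1 2 t - t ^+ k * arcsine_density 2 pi^-1 0 t.
  by rewrite -free_density1E -free_density2E mulrBr.
have hg : leb.-integrable setT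
    (EFin \o (fun t : R => t ^+ k * (free_density1 t - free_density2 t))).
  apply: eq_integrable (integrableB measurableT i1 i2) => // t _.
  by rewrite /= e EFinB.
rewrite (charge_integral_density _ integrable_free_density (measurable_exprn k) hg) //.
under eq_Rintegral do rewrite e.
by rewrite RintegralB // !Rintegral_arcsine_density // addn2 addn0.
Qed.

Lemma integrable_monotone_density : leb.-integrable setT (EFin \o @monotone_density R).
Proof. by rewrite monotone_densityE; exact: integrable_arcsine_density0. Qed.

Definition monotone_charge : {charge set TR -> \bar R} :=
  induced_charge integrable_monotone_density.

Lemma monotone_charge_moment k : second_derivative_moment monotone_charge k
  = k%:R * (2 * pi)^-1 * arcsine_moment (Num.sqrt 2) k.
Proof.
have ii := integrable_arcsine_density sqrt2_gt0 (- (2 * pi)^-1) 1 k.-1.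
have e (t : R) : k%:R * t ^+ k.-1 * monotone_density t
    = k%:R * (t ^+ k.-1 * arcsine_density (Num.sqrt 2) (- (2 * pi)^-1) 1 t).
  by rewrite -monotone_densityE mulrA.
have hg : leb.-integrable setT
    (EFin \o (fun t : R => k%:R * t ^+ k.-1 * monotone_density t)).
  apply: eq_integrable (integrableZl measurableT k%:R ii) => // t _.
  by rewrite /= e EFinM.
have hm : measurable_fun [set: R] (fun t : R => k%:R * t ^+ k.-1).
  by apply: measurable_funM; [exact: measurable_cst | exact: measurable_exprn].
rewrite /second_derivative_moment.
rewrite (charge_integral_density _ integrable_monotone_density hm hg) //.
under eq_Rintegral do rewrite e.
rewrite RintegralZl // Rintegral_arcsine_density // addn1.
(* At k = 0 the index [k.-1 + 1] is not [k], but the factor [k%:R] is zero. *)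
by case: k {ii e hg hm} => [|k]; rewrite ?mul0r ?oppr0 //= mulNr mulrN opprK mulrA.
Qed.

Definition monotone_primitive (t : R) : R := (2 * pi)^-1 * semicircle (Num.sqrt 2) t.

Lemma monotone_bv : bv_with_differential (- Num.sqrt 2) (Num.sqrt 2)
  monotone_primitive monotone_charge.
Proof.
split.
- by apply: bounded_variation_semicircle => //; rewrite invr_ge0 mulr_ge0 // pi_ge0.
- move=> t h; rewrite /monotone_primitive semicircle_out ?mulr0 //.
  by move=> /andP[h1 h2]; apply: h; rewrite !ltW.
- move=> s t st; rewrite /monotone_charge /= /induced_charge.
  have e (x : R) : (monotone_density x)%:E
      = ((2 * pi)^-1%:E * (arcsine_density (Num.sqrt 2) (- 1) 1 x)%:E)%E.
    have -> : monotone_density x = arcsine_density (Num.sqrt 2) (- (2 * pi)^-1) 1 x.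
      by rewrite -monotone_densityE.
    by rewrite -EFinM /arcsine_density !mulrA mulrN mulr1.
  under eq_integral do rewrite /= e.
  rewrite integralZl //; last first.
    by apply: (integrableS measurableT) => //; exact: integrable_arcsine_density0.
  by rewrite integral_semicircle // -EFinM mulrBr.
Qed.

End LimitCharges.

(** * The Boolean limit charge *)

Section BooleanCharge.
Variable R : realType.
Local Notation TR := (measurableTypeR R).

Lemma integrable_dirac (a : R) (g : R -> R) : measurable_fun setT g ->
  (@dirac _ TR a R).-integrable setT (EFin \o g).
Proof.
move=> mg; have mg' : measurable_fun setT (EFin \o g) by apply/measurable_EFinP.
apply/integrableP; split=> //; rewrite integral_dirac //; last exact: measurableT_comp.
by rewrite diracT mul1e ltry.
Qed.

Lemma Rintegral_dirac (a : R) (g : R -> R) : measurable_fun setT g ->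
  \int[@dirac _ TR a R]_t g t = g a.
Proof.
move=> mg; have mg' : measurable_fun setT (EFin \o g) by apply/measurable_EFinP.
rewrite -[LHS]/(fine (\int[@dirac _ TR a R]_t (EFin \o g) t)%E).
by rewrite integral_dirac // diracT mul1e.
Qed.

Lemma integrable_half (a : R) :
  (@dirac _ TR a R).-integrable setT (EFin \o (fun=> 2^-1 : R)).
Proof. by apply: integrable_dirac; exact: measurable_cst. Qed.

Let half_ge0 (x : R) : 0 <= (2^-1 : R). Proof. by []. Qed.

(** Half a point mass as a constant density, so that the integration rules for density measures
    apply. *)
Definition half_dirac (a : R) : {finite_measure set TR -> \bar R} :=
  density_measure (integrable_half a) half_ge0.

Lemma half_diracE a X : measurable X -> half_dirac a X = ((2^-1)%:E * \d_a X)%E.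
Proof.
move=> mX; rewrite [LHS]density_measureE integral_dirac // muleC //.
Qed.

Definition boolean_charge : {charge set TR -> \bar R} :=
  cadd (charge_of_finite_measure (half_dirac (-1)))
       (copp (charge_of_finite_measure (half_dirac 1))).

Lemma boolean_charge_diff X : boolean_charge X = (half_dirac (-1)%R X - half_dirac 1%R X)%E.
Proof. by []. Qed.

Lemma boolean_chargeE X : measurable X ->
  boolean_charge X = ((2^-1)%:E * (dirac (-1 : R)%R X - dirac (1 : R)%R X))%E.
Proof.
move=> mX; rewrite boolean_charge_diff !half_diracE // muleBr // !diracE.
Qed.

(** The pairing is -(k/2)((-1)^(k-1) - 1). The case k = 0 is apart because [k.-1] is truncated. *)
Lemma boolean_charge_moment k : second_derivative_moment boolean_charge k
  = if odd k then 0 else k%:R.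
Proof.
pose g (t : R) := k%:R * t ^+ k.-1.
have mg : measurable_fun setT g.
  by apply: measurable_funM; [exact: measurable_cst | exact: exprn_measurable].
have mg' : measurable_fun setT (EFin \o g) by apply/measurable_EFinP.
have ig a : (@dirac _ TR a R).-integrable setT (EFin \o (fun x => g x * 2^-1)).
  by apply: integrable_dirac; apply: measurable_funM => //; exact: measurable_cst.
have ih a : (half_dirac a).-integrable setT (EFin \o g).
  exact: (integrable_density (integrable_half a) half_ge0 mg' (ig a)).
rewrite /second_derivative_moment.
rewrite (charge_integral_diff (fun X _ => boolean_charge_diff X) (ih _) (ih _)).
rewrite !Rintegral_density // !Rintegral_dirac;
  try by apply: measurable_funM => //; exact: measurable_cst.
rewrite /g expr1n; case: k {g mg mg' ig ih} => [|k]; first by rewrite !mul0r subrr oppr0.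
by rewrite /= -signr_odd; case: odd => /=; rewrite ?expr1 ?expr0; field.
Qed.

(** Right-continuity at both jumps matches the half-open intervals ]s, t] on which the differential
    is tested. *)
Definition boolean_primitive (t : R) : R := if -1 <= t < 1 then 2^-1 else 0.

Lemma boolean_bv : bv_with_differential (-1) 1 boolean_primitive boolean_charge.
Proof.
split.
- have -> : boolean_primitive = \- (\- boolean_primitive).
    by apply/funext => x /=; rewrite opprK.
  apply: bounded_variationN; apply: nondecreasing_bounded_variation => x y.
  rewrite !in_itv /= => /andP[x1 x2] /andP[y1 y2] xy.
  rewrite lerN2 /boolean_primitive x1 y1 /=.
  by case: ltP => h1; case: ltP => h2 //; lra.
- move=> t h; rewrite /boolean_primitive; case: ifP => // /andP[h1 h2].
  by case: h; rewrite h1 ltW.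
- move=> s t st; rewrite boolean_chargeE; last exact: measurable_itv.
  rewrite !diracE !mem_setE !in_itv /= -EFinB -EFinM /boolean_primitive; congr EFin.
  case: (leP (-1) t) => h1; case: (leP (-1) s) => h2; case: (leP 1 t) => h3;
    case: (leP 1 s) => h4 /=; rewrite ?mulr1n ?mulr0n; lra.
Qed.

End BooleanCharge.

(** * Closed forms for the moments of the limit charges *)

Section MomentValues.
Variable R : realType.

Let pi0 : (pi : R) != 0. Proof. by rewrite gt_eqF // pi_gt0. Qed.

(** For k = 2p the difference of arcsine moments is C(2p+2, p+1) / 2 - C(2p, p) = p C(2p, p) / (p +
    1), which is p times the Catalan number. *)
Lemma free_charge_value k : charge_integral (free_charge R) (fun t => t ^+ k)
  = if odd k then 0 else (k./2)%:R * (catalan k./2)%:R.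
Proof.
rewrite free_charge_integral; case: ifPn => [ok|ek].
  by rewrite !arcsine_moment_odd //= ?negbK // !mulr0 subrr.
have -> : k = k./2.*2 by rewrite even_halfK.
rewrite doubleK -doubleS !arcsine_moment_even //.
have -> : (2 ^+ 2 / 4 : R) = 1 by field.
rewrite !expr1n !mulr1; move: (k./2) => p.
have p0 : p.+1%:R != 0 :> R by rewrite pnatr_eq0.
have := congr1 (fun n : nat => n%:R : R) (central_binS p).
have := congr1 (fun n : nat => n%:R : R) (mul_catalan p).
have e1 : p.*2.+1.*2%:R = 2 * (2 * p%:R + 1) :> R.
  by rewrite -(mul2n p.*2.+1) natrM -(addn1 p.*2) natrD -(mul2n p) natrM.
have e2 : p.+1%:R = p%:R + 1 :> R by rewrite natr1.
rewrite !natrM e1 => hc hb; rewrite -hc in hb *.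
apply: (mulfI p0); rewrite mulrBr !mulrA.
transitivity (2^-1 * (p.+1%:R * 'C(p.+1.*2, p.+1)%:R)
  - p.+1%:R * (p.+1%:R * (catalan p)%:R) : R); 
  first by move: (pi : R) pi0 => q q0; field.
by rewrite hb e2; field.
Qed.

Lemma monotone_charge_value k : second_derivative_moment (monotone_charge R) k
  = if odd k then 0 else (k./2)%:R * (odd_factorial k./2)%:R / (k./2)`!%:R.
Proof.
rewrite monotone_charge_moment; have s0 : 0 < Num.sqrt (2 : R) by rewrite sqrtr_gt0.
case: ifPn => [ok|ek]; first by rewrite arcsine_moment_odd // mulr0.
have -> : k = k./2.*2 by rewrite even_halfK.
rewrite doubleK arcsine_moment_even // sqr_sqrtr //; move: (k./2) => p; rewrite -[RHS]mulrA.
(* (2p - 1)!! / p! = C(2p, p) / 2^p; the base 2 / 4 is r^2 / 4 for r = sqrt 2. *)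
have -> : (odd_factorial p)%:R / p`!%:R = 'C(p.*2, p)%:R * (2 / 4 : R) ^+ p.
  elim: p => [|p IH]; first by rewrite bin0 expr0 divr1 mulr1.
  have p0 : p.+1%:R != 0 :> R by rewrite pnatr_eq0.
  have f0 : p`!%:R != 0 :> R by rewrite pnatr_eq0 -lt0n fact_gt0.
  have hb := congr1 (fun n : nat => n%:R : R) (central_binS p).
  have e1 : p.*2.+1.*2%:R = 2 * p.*2.+1%:R :> R by rewrite -mul2n natrM.
  rewrite !natrM e1 in hb; apply: (mulfI p0).
  rewrite exprS [LHS](_ : _ = p.*2.+1%:R * ((odd_factorial p)%:R / p`!%:R)).
    rewrite IH; transitivity ((p.+1%:R * 'C(p.+1.*2, p.+1)%:R)
      * (2 / 4 * (2 / 4) ^+ p) : R); last by rewrite !mulrA.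
    by rewrite hb; field.
  rewrite factS -[odd_factorial p.+1]/(p.*2.+1 * odd_factorial p)%N !natrM.
  move: (p.+1%:R : R) (p`!%:R : R) (p.*2.+1%:R : R) p0 f0 => a b c a0 b0.
  by field; rewrite a0 b0.
by rewrite -mul2n natrM; move: (pi : R) pi0 => q q0; field.
Qed.

End MomentValues.

Local Open Scope complex_scope.

Theorem theorem5p5 (R : realType) (A : algType R[i]) (phi phi' : {scalar A})
    (a : nat -> A) (alpha : R[i])
    (phi_unit : phi 1 = 1) (phi'_unit : phi' 1 = 0)
    (same_distr : identically_distributed phi phi' a)
    (phi_mean : phi (a 0%N) = 0) (phi'_mean : phi' (a 0%N) = 0)
    (phi_var : phi (a 0%N ^+ 2) = 1) (phi'_var : phi' (a 0%N ^+ 2) = alpha) :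
  exists (nu : {charge set (measurableTypeR R) -> \bar R})
         (fB fM : R -> R) (dfB dfM : {charge set (measurableTypeR R) -> \bar R}),
  [/\ forall X, measurable X ->
        nu X = (with_density (@free_density1 R) X
                - with_density (@free_density2 R) X)%E,
      bv_with_differential (-1) 1 fB dfB /\
      (forall X, measurable X -> dfB X = ((2^-1)%:E * (dirac (-1 : R)%R X - dirac (1 : R)%R X))%E),
      bv_with_differential (- Num.sqrt 2) (Num.sqrt 2) fM dfM /\
      (forall X, measurable X -> dfM X = with_density (@monotone_density R) X)
    & forall k : nat,
      let moment N : R[i]^o := phi' (normalized_sum a N ^+ k) in
      [/\ inf_free phi phi' (fun i => alg1 (a i)) ->
          moment N @[N --> \oo] -->
            (alpha * (charge_integral nu (fun t => t ^+ k))%:C : R[i]^o),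
          inf_boolean phi phi' (fun i => alg1 (a i)) ->
          moment N @[N --> \oo] -->
            (alpha * (second_derivative_moment dfB k)%:C : R[i]^o),
          inf_boolean phi phi' (fun i => alg0 (a i)) ->
          moment N @[N --> \oo] -->
            (alpha / 2 * (second_derivative_moment dfB k)%:C : R[i]^o)
        & inf_monotone phi phi' (fun i => alg1 (a i)) \/
          inf_monotone phi phi' (fun i => alg0 (a i)) ->
          moment N @[N --> \oo] -->
            (alpha * (second_derivative_moment dfM k)%:C : R[i]^o)]].
Proof.
exists (free_charge R), (@boolean_primitive R), (@monotone_primitive R),
  (boolean_charge R), (monotone_charge R).
split.
- by move=> X mX; exact: free_chargeE.
- by split; [exact: boolean_bv | move=> X mX; exact: boolean_chargeE].
- by split; [exact: monotone_bv |].
move=> k moment; split.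
- move=> hF; rewrite free_charge_value.
  suff -> : alpha * (if odd k then 0 else (k./2)%:R * (catalan k./2)%:R)%:C
      = if odd k then 0 else alpha * ((k./2)%:R * (catalan k./2)%:R).
    exact: (free_limit phi_unit phi'_unit same_distr phi_mean phi'_mean
      phi_var phi'_var hF).
  by case: odd; [rewrite rmorph0 mulr0 | rewrite (rmorphM (real_complex R)) !rmorph_nat].
(* Vacuous: with 1 among the letters, Boolean independence contradicts unit variance. *)
- by move=> hB; case: (boolean_alg1_absurd same_distr phi_mean phi'_mean phi_var hB).
(* For k = 2p the pairing with the charge of constant 1/2 is 2p, while the limit is p alpha; hence
   the factor alpha / 2. *)
- move=> hB; rewrite boolean_charge_moment.
  suff -> : alpha / 2 * (if odd k then 0 else k%:R)%:C
      = if odd k then 0 else alpha * (k./2)%:R.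
    exact: (boolean_limit phi_unit phi'_unit same_distr phi_mean phi'_mean
      phi_var phi'_var hB).
  have [ok|ek] := boolP (odd k); first by rewrite rmorph0 mulr0.
  have -> : k%:R = 2 * (k./2)%:R :> R by rewrite -natrM mul2n even_halfK.
  by rewrite (rmorphM (real_complex R)) !rmorph_nat mulrA divfK // pnatr_eq0.
- move=> hM; rewrite monotone_charge_value.
  suff -> : alpha * (if odd k then 0
        else (k./2)%:R * (odd_factorial k./2)%:R / (k./2)`!%:R)%:C
      = if odd k then 0
        else alpha * ((k./2)%:R * (odd_factorial k./2)%:R / (k./2)`!%:R).
    exact: (monotone_limit phi_unit phi'_unit same_distr phi_mean phi'_mean
      phi_var phi'_var hM).
  by case: odd; [rewrite rmorph0 mulr0 | rewrite (fmorph_div (real_complex R)) rmorphM !rmorph_nat].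
Qed.
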